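(* Let $(X,d)$ be a metric space with bounded geometry. The following are equivalent: \begin{enumerate} \item[(1)] $X$ has Property A; \item[(2)] $X$ has the metric sparsification property; \item[(3)] for any $\varepsilon>0$, $L>0$ and $M>0$, there exists $s>0$, such that for any operator $b \in \mathfrak{B}(\ell^2(X))$ with $\|b\|\leq M$ and $b \in \mathrm{Commut}(L,\frac{\varepsilon}{6})$, there exists a unit vector $v \in \ell^2(X)$ with $\mathrm{diam}(\mathrm{supp}\, v) \leq s$, and satisfying $\|bv\| \geq \|b\|-\varepsilon$; \item[(4)] for any $c\in (0,1)$ and $L>0$, there exists $s>0$, such that for any operator $b \in \mathfrak{B}(\ell^2(X))$ with $\|b\|=1$ and $b \in \mathrm{Commut}(L, \frac{1-c}{6})$, there exists a unit vector $v \in \ell^2(X)$ with $\mathrm{diam}(\mathrm{supp}\, v) \leq s$, and satisfying $\|bv\| \geq c$; \item[(5)] $X$ has the operator norm localisation property. \end{enumerate}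
   Context: Bounded geometry: for every $R\ge 0$, $\sup_{x\in X}\sharp B(x,R)<\infty$, where $B(x,R)$ is the closed ball and $\sharp$ denotes cardinality. $\mathfrak{B}(\cdot)$ denotes bounded linear operators; $\ell^2(X)=\ell^2(X;\mathbb C)$. $C_b(X)$ is the C*-algebra of bounded continuous complex-valued functions on $X$ with sup-norm, acting on $\ell^2(X)$ by point-wise multiplication; $C_b(X)_1$ is its closed unit ball. $[a,f]=af-fa$. For $L,\varepsilon>0$: $\mathrm{Commut}(L,\varepsilon)=\{a\in\mathfrak{B}(\ell^2(X)): \|[a,f]\|<\varepsilon \text{ for any } L\text{-Lipschitz } f\in C_b(X)_1\}$. Property A: for $p\in[1,\infty)$, a metric $p$-partition of unity on $X$ is a collection $\{\phi_i:X\to[0,1]\}_{i\in I}$ such that $\{\mathrm{supp}(\phi_i)\}_{i\in I}$ is uniformly bounded ($\sup_i\mathrm{diam}(\mathrm{supp}(\phi_i))<\infty$) and of finite multiplicity (some $M$ such that each $x\in X$ lies in at most $M$ of the supports), and $\sum_{i}\phi_i(x)^p=1$ for every $x$. It has $(r,\varepsilon)$-variation if $\sum_{i}|\phi_i(x)-\phi_i(y)|^p<\varepsilon^p$ whenever $d(x,y)\le r$. $X$ has Property A if for any $r,\varepsilon>0$ there exists a metric $p$-partition of unity with $(r,\varepsilon)$-variation (this is independent of $p\in[1,\infty)$). Metric sparsification property: for any $c\in(0,1)$ there exists a non-decreasing function $f:\mathbb N\to\mathbb N$ such that for any $m\in\mathbb N$ and any finite positive Borel measure $\mu$ on $X$ there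 is a Borel subset $\Omega=\bigsqcup_{i\in I}\Omega_i$ of $X$ such that $d(\Omega_i,\Omega_j)\ge m$ whenever $i\ne j$; $\mathrm{diam}(\Omega_i)\le f(m)$ for every $i\in I$; and $\mu(\Omega)\ge c\,\mu(X)$. An operator $a\in\mathfrak{B}(\ell^2(X))$ has propagation at most $R$ if $faf'=0$ for all $f,f'\in C_b(X)$ with $d(\mathrm{supp}(f),\mathrm{supp}(f'))>R$. Operator norm localisation property: for any $c\in(0,1)$ and $R>0$ there exists $S>0$ such that for any $a\in\mathfrak{B}(\ell^2(X))$ with propagation at most $R$ and norm $1$, there exists a unit vector $v\in\ell^2(X)$ with $\mathrm{diam}(\mathrm{supp}(v))\le S$ and $\|av\|\ge c$. *)

(* Defs.v *)
From HB Require Import structures.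
From mathcomp Require Import all_boot all_order all_algebra.
From mathcomp Require Import complex.
From mathcomp Require Import all_classical all_reals all_analysis.
From mathcomp Require Import ring lra.

Set Implicit Arguments.
Unset Strict Implicit.
Unset Printing Implicit Defensive.

Import Order.TTheory GRing.Theory Num.Theory.
Import numFieldNormedType.Exports.
Import Normc.

Local Open Scope classical_set_scope.
Local Open Scope card_scope.
Local Open Scope ring_scope.

(* A basepoint witnesses that the space is nonempty, and is what
   [measurableType] requires. *)
#[short(type="pmetricType")]
HB.structure Definition PointedMetric (K : numDomainType) :=
  {M of Metric K M & isPointed M}.

(* No closure is taken: if all balls are finite, every subset is closed. *)
Definition supp (T : Type) (V : nmodType) (f : T -> V) : set T :=
  [set x | f x != 0].

Section MetricNotions.
Context {R : realType} {X : metricType R}.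
Implicit Types (A B : set X).

(* diam set0 = -oo and set_dist set0 A = +oo. *)
Definition diam A : \bar R :=
  ereal_sup [set (mdist xy.1 xy.2)%:E | xy in A `*` A].

Definition set_dist A B : \bar R :=
  ereal_inf [set (mdist xy.1 xy.2)%:E | xy in A `*` B].

(* The library's [closed_ball] is the closure of the open ball, which can be
   smaller. *)
Definition cball (x : X) (r : R) : set X := [set y | mdist x y <= r].

End MetricNotions.

Definition bounded_geometry (R : realType) (X : metricType R) : Prop :=
  forall r : R, 0 <= r ->
    exists N : nat, forall x : X, cball x r #<= `I_N.

Section SquareSummable.
Context {R : realType} {X : choiceType}.
Local Notation C := R[i].
Implicit Types (u v : X -> C).

Definition sqsum v : \bar R := \esum_(x in [set: X]) (normc (v x) ^+ 2)%:E.

Definition sqsummable : {pred X -> C} := [pred v | `[< (sqsum v < +oo)%E >]].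

Lemma sqsummableP v : reflect (sqsum v < +oo)%E (v \in sqsummable).
Proof. by rewrite inE; exact: asboolP. Qed.

Lemma normc_ge0 (z : C) : 0 <= normc z.
Proof. by case: z => a b; exact: sqrtr_ge0. Qed.

Lemma sqsum_ge0 v : (0 <= sqsum v)%E.
Proof. by apply: esum_ge0 => x _; rewrite lee_fin sqr_ge0. Qed.

Lemma esumZ (a : R) (f : X -> R) : 0 <= a -> (forall x, 0 <= f x) ->
  (\esum_(x in [set: X]) (a * f x)%:E = a%:E * \esum_(x in [set: X]) (f x)%:E)%E.
Proof.
move=> a0 f0; have [->|an0] := eqVneq a 0.
  by rewrite mul0e esum1// => x _; rewrite mul0r.
have ap : 0 < a by rewrite lt_neqAle eq_sym an0.
have sumZ (b : R) (g : X -> R) (A : set X) : finite_set A ->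
    (\sum_(i \in A) (b * g i)%:E = b%:E * \sum_(i \in A) (g i)%:E)%E.
  by move=> finA; rewrite !fsbig_finite//= !sumEFin -EFinM mulr_sumr.
apply/eqP; rewrite eq_le; apply/andP; split.
- apply: ge_ereal_sup => _ [A [finA _] <-]; rewrite sumZ//.
  by rewrite lee_pmul2l//; apply: ereal_sup_ubound; exists A.
- rewrite -lee_pdivlMl//; apply: ge_ereal_sup => _ [A [finA _] <-].
  rewrite lee_pdivlMl// -sumZ//.
  by apply: ereal_sup_ubound; exists A.
Qed.

Lemma sqsum_mul_le (g : X -> C) (K : R) v : (forall x, normc (g x) <= K) ->
  (sqsum (fun x => g x * v x)%R <= (K ^+ 2)%:E * sqsum v)%E.
Proof.
move=> gK; rewrite -esumZ ?sqr_ge0// => [|x]; last exact: sqr_ge0.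
apply: le_esum => x _; rewrite lee_fin normcM exprMn ler_wpM2r ?sqr_ge0//.
by rewrite lerXn2r ?nnegrE ?normc_ge0// (le_trans (normc_ge0 _) (gK x)).
Qed.

Lemma sqsum_add_le (t : R) u v : 0 < t ->
  (sqsum (fun x => u x + v x)%R <=
     (1 + t)%:E * sqsum u + (1 + t^-1)%:E * sqsum v)%E.
Proof.
move=> t0; have t'0 : 0 < t^-1 by rewrite invr_gt0.
rewrite -!esumZ; [|lra|by move=> x; exact: sqr_ge0
                  |lra|by move=> x; exact: sqr_ge0].
rewrite -esumD; last 2 first.
- by move=> x _; rewrite lee_fin mulr_ge0 ?sqr_ge0//; lra.
- by move=> x _; rewrite lee_fin mulr_ge0 ?sqr_ge0//; lra.
apply: le_esum => x _; rewrite -EFinD lee_fin.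
have uv : normc (u x + v x) <= normc (u x) + normc (v x) by exact: le_normcD.
have := normc_ge0 (u x); have := normc_ge0 (v x).
have := normc_ge0 (u x + v x); move: uv.
move: (normc (u x + v x)) (normc (u x)) (normc (v x)) => c a b cab c0 b0 a0.
apply: (@le_trans _ _ ((a + b) ^+ 2)).
  by rewrite lerXn2r ?nnegrE ?addr_ge0.
rewrite -subr_ge0.
suff -> : (1 + t) * a ^+ 2 + (1 + t^-1) * b ^+ 2 - (a + b) ^+ 2 =
          t^-1 * (t * a - b) ^+ 2 by rewrite mulr_ge0 ?sqr_ge0// ltW.
by field; rewrite gt_eqF.
Qed.

Lemma sqsummable_submod : submod_closed sqsummable.
Proof.
split.
  apply/sqsummableP; rewrite /sqsum esum1 ?ltry// => x _.
  by rewrite normc0 expr0n.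
move=> a u v /sqsummableP us /sqsummableP vs; apply/sqsummableP.
apply: (le_lt_trans (sqsum_add_le (a *: u) v ltr01)).
rewrite lte_add_pinfty// lte_mul_pinfty//.
apply: (le_lt_trans (@sqsum_mul_le (fun=> a) (normc a) u _)) => //.
by rewrite lte_mul_pinfty// lee_fin sqr_ge0.
Qed.

HB.instance Definition _ :=
  GRing.isSubmodClosed.Build C (X -> C) sqsummable sqsummable_submod.

End SquareSummable.

Record ell2 (R : realType) (X : choiceType) := Ell2 {
  ell2_fun :> X -> R[i];
  _ : ell2_fun \in sqsummable
}.

Section Ell2Module.
Context (R : realType) (X : choiceType).

HB.instance Definition _ := [isSub for @ell2_fun R X].
HB.instance Definition _ := [Choice of ell2 R X by <:].
HB.instance Definition _ := [SubChoice_isSubLmodule of ell2 R X by <:].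

End Ell2Module.

Section Ell2Norm.
Context {R : realType} {X : choiceType}.
Implicit Types (u v : ell2 R X).

Definition l2norm v : R := Num.sqrt (fine (sqsum v)).

Lemma sqsum_fin_num v : sqsum v \is a fin_num.
Proof.
rewrite ge0_fin_numE ?sqsum_ge0//; apply/sqsummableP.
exact: (valP v).
Qed.

Lemma l2norm_ge0 v : 0 <= l2norm v.
Proof. exact: sqrtr_ge0. Qed.

Lemma sqr_l2norm v : (l2norm v ^+ 2)%:E = sqsum v.
Proof. by rewrite sqr_sqrtr ?fineK ?sqsum_fin_num// fine_ge0// sqsum_ge0. Qed.

Lemma l2norm_eq0 v : l2norm v = 0 -> v = 0.
Proof.
move=> v0; apply/val_inj/funext => x /=; apply/eq0_normc.
apply/eqP; rewrite -sqrf_eq0 eq_le sqr_ge0 andbT -lee_fin.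
have <- : sqsum v = 0%:E by rewrite -sqr_l2norm v0 expr0n.
rewrite -[leLHS](@esum_set1 _ _ x (fun y => (normc (v y) ^+ 2)%:E)); last first.
  by rewrite lee_fin sqr_ge0.
apply: ereal_sup_le => _ [A [finA _] <-].
by exists A => //; split.
Qed.

Lemma ler_l2normD u v : l2norm (u + v) <= l2norm u + l2norm v.
Proof.
set a := l2norm u; set b := l2norm v.
have a0 : 0 <= a by exact: l2norm_ge0.
have b0 : 0 <= b by exact: l2norm_ge0.
have H t : 0 < t -> l2norm (u + v) ^+ 2 <= (1 + t) * a ^+ 2 + (1 + t^-1) * b ^+ 2.
  move=> t0; rewrite -lee_fin EFinD (EFinM (1 + t)) (EFinM (1 + t^-1)) !sqr_l2norm.
  exact: sqsum_add_le.
apply/ler_addgt0Pl => e e0.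
have ae : 0 < a + e / 2 by lra.
have be : 0 < b + e / 2 by lra.
rewrite -[leLHS]ger0_norm ?l2norm_ge0// -[leRHS]ger0_norm; last by lra.
rewrite -ler_sqr ?nnegrE//.
rewrite !ger0_norm ?l2norm_ge0//; last by lra.
apply: (le_trans (H ((b + e / 2) / (a + e / 2)) (divr_gt0 be ae))).
set p := a + e / 2 in ae *; set q := b + e / 2 in be *.
have -> : e + (a + b) = p + q by rewrite /p /q; lra.
have -> : (p + q) ^+ 2 = (1 + q / p) * p ^+ 2 + (1 + (q / p)^-1) * q ^+ 2.
  by field; rewrite !gt_eqF.
have qp : 0 < q / p by rewrite divr_gt0.
apply: lerD; rewrite ler_wpM2l ?addr_ge0 ?invr_ge0 ?(ltW qp)//.
  by rewrite lerXn2r ?nnegrE ?(ltW ae)// /p; lra.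
by rewrite lerXn2r ?nnegrE ?(ltW be)// /q; lra.
Qed.

Lemma l2normZ (c : R[i]) v : l2norm (c *: v) = normc c * l2norm v.
Proof.
apply/eqP; rewrite -(@eqrXn2 _ 2)// ?mulr_ge0 ?normc_ge0 ?l2norm_ge0//.
apply/eqP/EFin_inj; rewrite exprMn (EFinM (normc c ^+ 2)) !sqr_l2norm -esumZ ?sqr_ge0//.
  by apply: eq_esum => x _ /=; rewrite normcM exprMn.
by move=> x; exact: sqr_ge0.
Qed.

Lemma l2normN v : l2norm (- v) = l2norm v.
Proof.
by rewrite -scaleN1r l2normZ -[normc _]/(normc (- 1)) normcN normc1 mul1r.
Qed.

End Ell2Norm.

Record bounded_op (R : realType) (X : choiceType) := BoundedOp {
  op_fun :> {linear ell2 R X -> ell2 R X};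
  op_bounded : exists K : R, forall v, l2norm (op_fun v) <= K * l2norm v
}.

Section BoundedOperators.
Context {R : realType} {X : choiceType}.
Implicit Types a b : bounded_op R X.

Definition opnorm a : R := sup [set l2norm (a v) | v in [set v | l2norm v <= 1]].

Lemma op_bounded_ge0 a :
  exists2 K : R, 0 <= K & forall v, l2norm (a v) <= K * l2norm v.
Proof.
have [K aK] := op_bounded a; exists `|K| => // v.
by apply: (le_trans (aK v)); rewrite ler_wpM2r ?l2norm_ge0// ler_norm.
Qed.

Lemma ler_opnorm a v : l2norm (a v) <= opnorm a * l2norm v.
Proof.
have [K K0 aK] := op_bounded_ge0 a.
have [v0|v0] := eqVneq (l2norm v) 0.
  by have := aK v; rewrite v0 !mulr0.
have vp : 0 < l2norm v by rewrite lt_neqAle eq_sym v0 l2norm_ge0.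
rewrite -ler_pdivrMr//.
have nV : normc ((l2norm v)^-1)%:C%C = (l2norm v)^-1.
  by rewrite /normc /= expr0n /= addr0 sqrtr_sqr ger0_norm// invr_ge0 ltW.
have -> : l2norm (a v) / l2norm v = l2norm (a (((l2norm v)^-1)%:C%C *: v)).
  by rewrite linearZ/= l2normZ nV mulrC.
apply: ub_le_sup.
  exists K => _ [w /= w1 <-]; apply: (le_trans (aK w)).
  by rewrite ler_piMr.
by exists (((l2norm v)^-1)%:C%C *: v) => //=; rewrite l2normZ nV mulVf.
Qed.

Lemma op_comp_bounded a b :
  exists K : R, forall v, l2norm ((a \o b) v) <= K * l2norm v.
Proof.
have [K K0 aK] := op_bounded_ge0 a; have [L L0 bL] := op_bounded_ge0 b.
exists (K * L) => v /=; apply: (le_trans (aK _)).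
by rewrite -mulrA ler_wpM2l.
Qed.

Lemma op_sub_bounded a b :
  exists K : R, forall v, l2norm ((a \- b) v) <= K * l2norm v.
Proof.
have [K aK] := op_bounded a; have [L bL] := op_bounded b.
exists (K + L) => v /=; apply: (le_trans (ler_l2normD _ _)).
by rewrite l2normN mulrDl lerD.
Qed.

Definition op_comp a b : bounded_op R X := BoundedOp (op_comp_bounded a b).

Definition op_sub a b : bounded_op R X := BoundedOp (op_sub_bounded a b).

End BoundedOperators.

Record bounded_cont (R : realType) (X : metricType R) := BoundedCont {
  bc_fun :> X -> R[i];
  bc_continuous : continuous (bc_fun : X -> R[i]^o);
  bc_bounded : exists K : R, forall x, normc (bc_fun x) <= K
}.

Section MultiplicationOperators.
Context {R : realType} {X : metricType R}.
Implicit Types (f : bounded_cont X) (v : ell2 R X).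

Definition sup_norm f : R := sup (range (fun x => normc (f x))).

Lemma mul_sqsummable f v : (fun x => f x * v x) \in @sqsummable R X.
Proof.
have [K fK] := bc_bounded f; apply/sqsummableP.
apply: (le_lt_trans (sqsum_mul_le v fK)).
by rewrite -sqr_l2norm -EFinM ltry.
Qed.

Definition mul_fun f v : ell2 R X := Ell2 (mul_sqsummable f v).

Lemma mul_linear f : linear (mul_fun f).
Proof.
move=> a u v; apply/val_inj/funext => x.
rewrite -[LHS]/(f x * (a * u x + v x)) -[RHS]/(a * (f x * u x) + f x * v x).
by ring.
Qed.

HB.instance Definition _ f :=
  GRing.isLinear.Build R[i] (ell2 R X) (ell2 R X) *:%R (mul_fun f) (mul_linear f).

Lemma mul_bounded f :
  exists K : R, forall v, l2norm (mul_fun f v) <= K * l2norm v.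
Proof.
have [K fK] := bc_bounded f; exists `|K| => v.
rewrite -ler_sqr ?nnegrE ?mulr_ge0 ?l2norm_ge0// exprMn -lee_fin.
rewrite (EFinM (`|K| ^+ 2)) !sqr_l2norm real_normK ?num_real//.
exact: sqsum_mul_le.
Qed.

Definition mul_op f : bounded_op R X := BoundedOp (mul_bounded f).

Definition commutator (a : bounded_op R X) f : bounded_op R X :=
  op_sub (op_comp a (mul_op f)) (op_comp (mul_op f) a).

End MultiplicationOperators.

Definition lipschitz_fun (R : realType) (X : metricType R) (L : R)
    (f : X -> R[i]) : Prop :=
  forall x y, normc (f x - f y) <= L * mdist x y.

Definition Commut (R : realType) (X : metricType R) (L eps : R) :
    set (bounded_op R X) :=
  [set a | forall f : bounded_cont X, sup_norm f <= 1 ->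
     lipschitz_fun L f -> opnorm (commutator a f) < eps].

Definition metric_partition (R : realType) (X : metricType R) (p : R)
    (I : choiceType) (phi : I -> X -> R) : Prop :=
  [/\ forall i x, 0 <= phi i x <= 1,
      (ereal_sup (range (fun i => diam (supp (phi i)))) < +oo)%E,
      exists M : nat, forall x, [set i | supp (phi i) x] #<= `I_M &
      forall x, \esum_(i in [set: I]) (phi i x `^ p)%:E = 1%E].

Definition has_variation (R : realType) (X : metricType R) (p r eps : R)
    (I : choiceType) (phi : I -> X -> R) : Prop :=
  forall x y, mdist x y <= r ->
    (\esum_(i in [set: I]) (`|phi i x - phi i y| `^ p)%:E < (eps `^ p)%:E)%E.

Definition property_A (R : realType) (X : metricType R) (p : R) : Prop :=
  forall r eps : R, 0 < r -> 0 < eps ->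
    exists (I : choiceType) (phi : I -> X -> R),
      metric_partition p phi /\ has_variation p r eps phi.

Definition metric_sparsification (R : realType) (X : pmetricType R) : Prop :=
  forall c : R, 0 < c < 1 ->
    exists2 f : nat -> nat, {homo f : m n / (m <= n)%N} &
      forall (m : nat)
          (mu : {finite_measure set (g_sigma_algebraType (@open X)) -> \bar R}),
        exists (I : Type) (Om : I -> set X),
          [/\ trivIset [set: I] Om,
              measurable
                (\bigcup_i Om i : set (g_sigma_algebraType (@open X))),
              forall i j, i <> j -> (m%:R%:E <= set_dist (Om i) (Om j))%E,
              forall i, (diam (Om i) <= (f m)%:R%:E)%E &
              (c%:E * mu [set: X] <= mu (\bigcup_i Om i))%E].

Definition propagation_le (R : realType) (X : metricType R) (r : R)
    (a : bounded_op R X) : Prop :=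
  forall f f' : bounded_cont X, (r%:E < set_dist (supp f) (supp f'))%E ->
    forall v, op_comp (op_comp (mul_op f) a) (mul_op f') v = 0.

Definition operator_norm_localisation (R : realType) (X : metricType R) : Prop :=
  forall c r : R, 0 < c < 1 -> 0 < r ->
    exists2 s : R, 0 < s &
      forall a : bounded_op R X, propagation_le r a -> opnorm a = 1 ->
        exists v : ell2 R X,
          [/\ l2norm v = 1, (diam (supp v) <= s%:E)%E & c <= l2norm (a v)].

(* Main.v *)
From HB Require Import structures.
Require Import Defs.
From mathcomp Require Import all_boot all_order all_algebra.
From mathcomp Require Import complex.
From mathcomp Require Import all_classical all_reals all_analysis.
From mathcomp Require Import ring lra.

Set Implicit Arguments.
Unset Strict Implicit.
Unset Printing Implicit Defensive.

Import Order.TTheory GRing.Theory Num.Theory.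
Import numFieldNormedType.Exports.
Import Normc.

Local Open Scope classical_set_scope.
Local Open Scope ring_scope.

(** The five statements are proved equivalent in a cycle, in the order in which they are
    listed.

    Property A gives sparsification ([property_A_sparsification]). The p-th powers of a
    partition of unity with exponent p have small l1 variation. On a finite set of
    weighted points, averaging over the members of the partition and then over the level
    sets of a member yields a set of bounded diameter whose boundary weighs little
    compared with the set ([property_A_folner]). Collecting it, discarding its boundary
    and repeating ([greedy_blocks]) collects most of the mass in pieces that are far
    apart; and most of the mass of a finite measure lies on a finite set.

    Sparsification gives the third statement ([sparsification_localises]). Sparsify the
    measure |v|^2 for a vector v that nearly attains the norm of b, and cut v down to the
    pieces, with blocks w_i and sum w. The pieces are far apart, so every choice of signs
    on them extends to an L-Lipschitz function f. Since b almost commutes with f, the norm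
    of b (f w) is nearly at least that of b w, for all signs. For suitable signs its
    square is at most the sum of the |b w_i|^2, so some block nearly attains the norm.

    The fourth statement is a special case of the third. It gives operator norm
    localisation because by Schur's test an operator with norm 1 and bounded propagation
    almost commutes with L-Lipschitz functions for small L ([propagation_Commut]).

    That localisation implies Property A is a theorem of Sako, proved here by duality in
    finite dimension. Call a vector local if the diameter of its support is bounded by a
    suitable constant. On a finite set of points one looks for local vectors v_j whose
    Gram matrix, with entries the sums over j of v_j(x) v_j(y), is nearly 1 at all pairs
    at distance at most r. If there are none, then a hyperplane separates the Gram
    matrices from the wanted ones ([cone_separation]). Rescaled by its diagonal, the
    separating functional is a symmetric matrix T with nonnegative entries and bounded
    propagation whose quadratic form is at most the identity on local vectors, but not on
    all vectors, by a definite factor. Polarisation shows that T does not increase the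
    norm of local vectors, so by localisation the norm of T is not much larger than 1, a
    contradiction ([localises_form], [gram_family]). The squares of the v_j form a
    partition of unity on the finite set ([finite_partition]), and compactness of a cube
    gives one on the whole space ([localisation_property_A]). *)

(** * Separation of a point from a convex cone *)

Lemma closure_stable (T : topologicalType) (A : set T) (g : T -> T) (p : T) :
  continuous g -> (forall a, A a -> A (g a)) -> closure A p -> closure A (g p).
Proof.
move=> cg gA Ap B /cg Bp; have [a [Aa Ba]] := Ap _ Bp.
by exists (g a); split => //; exact: gA.
Qed.

(** The first-order condition at a minimum over a cone. *)
Lemma quadratic_ge0 (R : realFieldType) (a b : R) :
  0 <= b -> (forall t, 0 < t <= 1 -> 0 <= 2 * t * a + t ^+ 2 * b) -> 0 <= a.
Proof.
move=> b0 H; rewrite leNgt; apply/negP => a0.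
have ba : 0 < b - a by lra.
have t0 : 0 < - a / (b - a) <= 1.
  by rewrite divr_gt0 ?oppr_gt0//= ler_pdivrMr// mul1r; lra.
have := H _ t0; set t := _ / _ in t0 *; have {t0} [t0 t1] := andP t0.
have tE : t * (b - a) = - a by rewrite /t mulfVK// gt_eqF.
have : 0 < t * - a by rewrite mulr_gt0// oppr_gt0.
nra.
Qed.

(** By compactness the closed cone has a point nearest to [tau]; the vector from [tau]
    to that point is the separating functional. *)
Lemma cone_separation_rV (R : realType) (n : nat) (K : set 'rV[R]_n)
    (tau : 'rV[R]_n) :
  K 0 -> (forall u v, K u -> K v -> K (u + v)) ->
  (forall t u, 0 <= t -> K u -> K (t *: u)) ->
  closure K tau \/
  exists ell : 'rV[R]_n, (forall u, K u -> 0 <= \sum_j ell 0 j * u 0 j) /\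
    \sum_j ell 0 j * tau 0 j < 0.
Proof.
move=> K0 KD KZ.
pose f (v : 'rV[R]_n) := \sum_j (v 0 j - tau 0 j) ^+ 2.
have f_cont : continuous f.
  apply: continuous_big => [[u v]|j _ v]; first exact: add_continuous.
  apply: (@continuous_comp _ _ _ (fun v : 'rV[R]_n => v 0 j - tau 0 j)
                                 (fun y => y ^+ 2)); last exact: exprn_continuous.
  by apply: continuousB; [exact: coord_continuous|exact: cst_continuous].
(* cutting the cone down to the sublevel set of the origin makes it compact *)
pose A := closure K `&` f @^-1` [set y | y <= f 0].
have A0 : A 0 by split; [exact: subset_closure|exact: lexx].
have cA : compact A.
  apply: bounded_closed_compact.
    exists (Num.sqrt (f 0) + `|tau|); split; first exact: num_real.
    move=> M fM v [_ /= fv]; apply: (le_trans _ (ltW fM)).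
    rewrite -[v](subrK tau); apply: (le_trans (ler_normD _ _)).
    rewrite lerD2r /Num.Def.normr/= mx_normrE; apply/bigmax_leP; split => /=.
      exact: sqrtr_ge0.
    move=> [i j] _ /=; rewrite !mxE -sqrtr_sqr ler_wsqrtr//.
    apply: (le_trans _ fv); rewrite ord1 /f (bigD1 j)//= lerDl.
    by apply: sumr_ge0 => k _; exact: sqr_ge0.
  apply: closedI; first exact: closed_closure.
  by apply: closed_comp => [v _|]; [exact: f_cont|exact: closed_le].
have [p pA p_min] : exists2 p, p \in A & forall t, t \in A -> f p <= f t.
  apply: compact_EVT_min => //; first by exists 0.
  exact: continuous_subspaceT.
have {pA} [Cp fp0] : A p by rewrite inE in pA.
have {}p_min u : closure K u -> f p <= f u.
  move=> Cu; have [fu|/ltW fu] := leP (f u) (f 0).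
    by apply: p_min; rewrite inE; split.
  exact: le_trans fp0 fu.
have [fp|fp] := eqVneq (f p) 0.
  left; suff -> : tau = p by [].
  apply/rowP => j; apply/esym/eqP; rewrite -subr_eq0 -sqrf_eq0; apply/eqP.
  by apply: (psumr_eq0P _ fp) => // i _; exact: sqr_ge0.
right; exists (p - tau).
have dir t u : closure K (p + t *: u) ->
    0 <= 2 * t * (\sum_j (p - tau) 0 j * u 0 j) + t ^+ 2 * \sum_j (u 0 j) ^+ 2.
  move=> /p_min; rewrite -subr_ge0; suff -> : f (p + t *: u) - f p =
    2 * t * (\sum_j (p - tau) 0 j * u 0 j) + t ^+ 2 * \sum_j (u 0 j) ^+ 2 by [].
  rewrite /f -sumrB !mulr_sumr -big_split/=; apply: eq_bigr => j _.
  by rewrite !mxE; ring.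
have sq0 (u : 'rV[R]_n) : 0 <= \sum_j (u 0 j) ^+ 2.
  by apply: sumr_ge0 => j _; exact: sqr_ge0.
split=> [u Ku|].
  apply: (quadratic_ge0 (sq0 u)) => t /andP[t0 _]; apply: dir.
  apply: (@closure_stable 'rV[R]_n K (fun q => q + t *: u) p) => //.
    by move=> q; apply: (@cvgD _ _ _ (nbhs q)); [exact: cvg_id|exact: cvg_cst].
  by move=> q Kq; apply: KD => //; apply: KZ => //; exact: ltW.
have ellp : 0 <= - \sum_j (p - tau) 0 j * p 0 j.
  apply: (quadratic_ge0 (sq0 p)) => t /andP[t0 t1].
  have /dir : closure K (p + (- t) *: p).
    rewrite scaleNr -[X in X - _]scale1r -scalerBl.
    apply: (@closure_stable 'rV[R]_n K (fun q => (1 - t) *: q) p) => //.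
      by move=> q; apply: (@cvgZl_tmp _ _ _ (nbhs q)); exact: cvg_id.
    by move=> q Kq; apply: KZ => //; lra.
  by rewrite sqrrN; lra.
have -> : \sum_j (p - tau) 0 j * tau 0 j =
    \sum_j (p - tau) 0 j * p 0 j - f p.
  by rewrite /f -sumrB; apply: eq_bigr => j _; rewrite !mxE; ring.
have : 0 <= f p by apply: sumr_ge0 => j _; exact: sqr_ge0.
by rewrite le_eqVlt eq_sym (negbTE fp)/=; lra.
Qed.

(** The same in coordinates indexed by a finite type, with membership in the closure
    replaced by coordinatewise approximation. *)
Lemma cone_separation (R : realType) (J : finType) (K : set (J -> R))
    (tau : J -> R) :
  K (fun=> 0) -> (forall u v, K u -> K v -> K (fun j => u j + v j)) ->
  (forall t u, 0 <= t -> K u -> K (fun j => t * u j)) ->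
  (forall eta, 0 < eta ->
     exists2 u, K u & forall j, `|u j - tau j| < eta) \/
  exists ell : J -> R, (forall u, K u -> 0 <= \sum_j ell j * u j) /\
    \sum_j ell j * tau j < 0.
Proof.
move=> K0 KD KZ.
pose row u : 'rV[R]_#|J| := \row_i u (enum_val i).
pose fn (v : 'rV[R]_#|J|) j := v 0 (enum_rank j).
have rowK u : fn (row u) = u by apply/funext => j; rewrite /fn mxE enum_rankK.
have sumE (F : J -> R) : \sum_(i < #|J|) F (enum_val i) = \sum_j F j.
  by rewrite -(@big_enum_val _ _ _ _ (fun=> true) F); exact: eq_bigl.
have [| | |clK|[ell [ellK ellt]]] := @cone_separation_rV R _ [set v | K (fn v)] (row tau).
- rewrite /= (_ : fn 0 = fun=> 0)//; apply/funext => j; exact: mxE.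
- move=> u v /= Ku Kv; rewrite (_ : fn _ = fun j => fn u j + fn v j); first exact: KD.
  by apply/funext => j; exact: mxE.
- move=> t u t0 /= Ku; rewrite (_ : fn _ = fun j => t * fn u j); first exact: KZ.
  by apply/funext => j; exact: mxE.
- left => eta eta0; have [v [Kv]] := clK _ (nbhsx_ballx _ _ eta0).
  move=> [_ tv]; exists (fn v) => // j; rewrite distrC.
  by have := tv ord0 (enum_rank j); rewrite /ball/= mxE enum_rankK.
- right; exists (fn ell); split => [u Ku|].
    rewrite -sumE (eq_bigr (fun i => ell 0 i * row u 0 i)) => [|i _].
      by apply: ellK; rewrite /= rowK.
    by rewrite /fn mxE enum_valK.
  rewrite -sumE (eq_bigr (fun i => ell 0 i * row tau 0 i))// => i _.
  by rewrite /fn mxE enum_valK.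
Qed.

(** * Finite and unordered sums *)

Lemma perm_filter_subset (I : eqType) (s t : seq I) :
  uniq s -> uniq t -> {subset s <= t} -> perm_eq [seq i <- t | i \in s] s.
Proof.
move=> us ut st; apply: uniq_perm; rewrite ?filter_uniq// => i.
by rewrite mem_filter; apply/andP/idP => [[]//|i_s]; split => //; exact: st.
Qed.

Lemma sum_le_subset (R : numDomainType) (I : eqType) (s t : seq I) (F : I -> R) :
  uniq s -> uniq t -> {subset s <= t} -> (forall i, 0 <= F i) ->
  \sum_(i <- s) F i <= \sum_(i <- t) F i.
Proof.
move=> us ut st F0; rewrite -(perm_big _ (perm_filter_subset us ut st)) big_filter.
by rewrite [leRHS](bigID (fun i => i \in s))/= lerDl sumr_ge0.
Qed.

Lemma sum_eq_subset (R : nmodType) (I : eqType) (s t : seq I) (F : I -> R) :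
  uniq s -> uniq t -> {subset s <= t} -> (forall i, i \notin s -> F i = 0) ->
  \sum_(i <- t) F i = \sum_(i <- s) F i.
Proof.
move=> us ut st F0; rewrite -(perm_big _ (perm_filter_subset us ut st)) big_filter.
by rewrite [LHS](bigID (fun i => i \in s))/= [X in _ + X]big1 ?addr0.
Qed.

Section UnorderedSums.
Context (R : realType) (X : choiceType).
Implicit Types (f : X -> R) (s : seq X).

Lemma sum_le_esum f s : uniq s ->
  ((\sum_(x <- s) f x)%:E <= \esum_(x in [set: X]) (f x)%:E)%E.
Proof.
move=> us; apply: ereal_sup_ubound; exists [set` s].
  by split => //; apply/finite_seqP; exists s.
by rewrite -fsbig_seq// sumEFin.
Qed.

Lemma esum_le f (K : \bar R) :
  (forall s, uniq s -> ((\sum_(x <- s) f x)%:E <= K)%E) ->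
  (\esum_(x in [set: X]) (f x)%:E <= K)%E.
Proof.
move=> fK; apply: ge_ereal_sup => _ [A [finA _] <-].
by rewrite fsbig_finite// sumEFin; exact/fK/finmap.fset_uniq.
Qed.

Lemma esum_seq f s : uniq s -> (forall x, 0 <= f x) ->
  (forall x, x \notin s -> f x = 0) ->
  \esum_(x in [set: X]) (f x)%:E = (\sum_(x <- s) f x)%:E.
Proof.
move=> us f0 fs; apply/eqP; rewrite eq_le sum_le_esum// andbT.
apply: esum_le => t ut; rewrite lee_fin.
rewrite [leLHS](bigID (mem s))/= [X in _ + X]big1 ?addr0//.
rewrite -big_filter; apply: sum_le_subset => //; first exact: filter_uniq.
by move=> x; rewrite mem_filter => /andP[].
Qed.

End UnorderedSums.

(** * Square-summable vectors *)

Section Ell2Basics.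
Context (R : realType) (X : choiceType).
Implicit Types (u v w : ell2 R X) (s : seq X) (A : set X).

Lemma sum_le_l2norm v s : uniq s ->
  \sum_(x <- s) normc (v x) ^+ 2 <= l2norm v ^+ 2.
Proof. by move=> us; rewrite -lee_fin sqr_l2norm; exact: sum_le_esum. Qed.

Lemma l2norm_le_sum v (K : R) : 0 <= K ->
  (forall s, uniq s -> \sum_(x <- s) normc (v x) ^+ 2 <= K ^+ 2) ->
  l2norm v <= K.
Proof.
move=> K0 vK; rewrite -ler_sqr ?nnegrE ?l2norm_ge0//.
by rewrite -lee_fin sqr_l2norm; apply: esum_le => s us; rewrite lee_fin vK.
Qed.

Lemma sqr_l2norm_seq v s : uniq s -> (forall x, x \notin s -> v x = 0) ->
  l2norm v ^+ 2 = \sum_(x <- s) normc (v x) ^+ 2.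
Proof.
move=> us vs; apply: EFin_inj; rewrite sqr_l2norm; apply: esum_seq => // x.
  exact: sqr_ge0.
by move=> /vs ->; rewrite normc0 expr0n.
Qed.

Lemma normc_le_l2norm v x : normc (v x) <= l2norm v.
Proof.
rewrite -ler_sqr ?nnegrE ?normc_ge0 ?l2norm_ge0//.
by have := @sum_le_l2norm v [:: x] isT; rewrite big_seq1.
Qed.

Lemma ell2_addE u v x : (u + v) x = u x + v x. Proof. by []. Qed.
Lemma ell2_subE u v x : (u - v) x = u x - v x. Proof. by []. Qed.
Lemma ell2_scaleE c u x : (c *: u) x = c * u x. Proof. by []. Qed.

Lemma ell2_sumE (I : Type) (r : seq I) (F : I -> ell2 R X) x :
  (\sum_(i <- r) F i) x = \sum_(i <- r) F i x.
Proof.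
elim: r => [|i r IH]; first by rewrite !big_nil.
by rewrite !big_cons ell2_addE IH.
Qed.

Lemma l2norm0 : l2norm (0 : ell2 R X) = 0.
Proof.
apply/eqP; rewrite -sqrf_eq0.
by rewrite (@sqr_l2norm_seq _ [::])// big_nil.
Qed.

Lemma restr_sqsummable A v :
  (fun x => if `[< A x >] then v x else 0) \in @sqsummable R X.
Proof.
apply/sqsummableP; apply: le_lt_trans (_ : sqsum v < +oo)%E; last first.
  by rewrite -sqr_l2norm ltry.
apply: le_esum => x _; case: ifP => // _; rewrite lee_fin normc0 expr0n.
exact: sqr_ge0.
Qed.

Definition restr A v : ell2 R X := Ell2 (restr_sqsummable A v).

Lemma restrT A v x : A x -> restr A v x = v x.
Proof. by move=> Ax /=; rewrite asboolT. Qed.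

Lemma restrF A v x : ~ A x -> restr A v x = 0.
Proof. by move=> Ax /=; rewrite asboolF. Qed.

Lemma sqr_l2norm_restr A v :
  l2norm v ^+ 2 = l2norm (restr A v) ^+ 2 + l2norm (v - restr A v) ^+ 2.
Proof.
apply: EFin_inj; rewrite EFinD !sqr_l2norm -esumD.
- apply: eq_esum => x _; rewrite -EFinD; congr EFin.
  rewrite ell2_subE /=; case: ifP => _.
    by rewrite subrr normc0 expr0n addr0.
  by rewrite subr0 normc0 expr0n add0r.
- by move=> x _; rewrite lee_fin sqr_ge0.
- by move=> x _; rewrite lee_fin sqr_ge0.
Qed.

Lemma l2norm_restr_le A v : l2norm (restr A v) <= l2norm v.
Proof.
rewrite -ler_sqr ?nnegrE ?l2norm_ge0//.
by rewrite (sqr_l2norm_restr A v) lerDl sqr_ge0.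
Qed.

Lemma restr_dense v (e : R) : 0 < e ->
  exists2 s, uniq s & l2norm (v - restr [set` s] v) <= e.
Proof.
move=> e0; have e20 : 0 < e ^+ 2 by rewrite exprn_gt0.
have [_ [A [finA _] <-]] : exists2 y,
    [set \sum_(x \in A) (normc (v x) ^+ 2)%:E | A in fsets [set: X]]%E y &
    ((l2norm v ^+ 2 - e ^+ 2)%:E < y)%E.
  apply: ereal_sup_gt; rewrite (_ : ereal_sup _ = sqsum v)// -sqr_l2norm lte_fin; lra.
rewrite fsbig_finite// sumEFin lte_fin; set s := finmap.enum_fset _ => vs.
have us : uniq s by exact: finmap.fset_uniq.
exists s => //; rewrite -ler_sqr ?nnegrE ?l2norm_ge0 ?(ltW e0)//.
have := sqr_l2norm_restr [set` s] v.
rewrite (@sqr_l2norm_seq (restr _ v) s us); last first.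
  by move=> x /negP xs; rewrite restrF.
rewrite (eq_big_seq (fun x => normc (v x) ^+ 2)); first by lra.
by move=> x xs; rewrite restrT.
Qed.

Lemma normc_sqr (z : R[i]) : normc z ^+ 2 = complex.Re z ^+ 2 + complex.Im z ^+ 2.
Proof. by case: z => a b; rewrite /normc sqr_sqrtr// addr_ge0 ?sqr_ge0. Qed.

Lemma parallelogram u v : l2norm (u + v) ^+ 2 + l2norm (u - v) ^+ 2 =
  2 * (l2norm u ^+ 2 + l2norm v ^+ 2).
Proof.
apply: EFin_inj; rewrite EFinM !EFinD !sqr_l2norm.
have ge0 w x : [set: X] x -> (0%:E <= (normc (w x) ^+ 2)%:E)%E.
  by move=> _; rewrite lee_fin sqr_ge0.
rewrite -!esumD; [|exact: ge0..].
rewrite (eq_esum (b := fun x => (2 * (normc (u x) ^+ 2 + normc (v x) ^+ 2))%:E)).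
  by rewrite esumZ// => x; rewrite addr_ge0 ?sqr_ge0.
move=> x _; rewrite -EFinD; congr EFin; rewrite ell2_addE ell2_subE !normc_sqr.
case: (u x) (v x) => [a b] [c d] /=; ring.
Qed.

(** Choose the signs in turn: by the parallelogram identity, one of the two choices
    increases the square of the norm by at most the square of the norm of the new term.
    This does the work of averaging over independent random signs. *)
Lemma greedy_signs (I : eqType) (r : seq I) (F : I -> ell2 R X) z : uniq r ->
  exists sg : I -> bool,
    l2norm (z + \sum_(i <- r) (-1) ^+ sg i *: F i) ^+ 2 <=
      l2norm z ^+ 2 + \sum_(i <- r) l2norm (F i) ^+ 2.
Proof.
elim: r z => [|j r IH] z /=; first by exists xpred0; rewrite !big_nil !addr0.
move=> /andP[jr ur].
have [b zb] : exists b : bool,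
    l2norm (z + (-1) ^+ b *: F j) ^+ 2 <= l2norm z ^+ 2 + l2norm (F j) ^+ 2.
  have := parallelogram z (F j).
  have [h _|h H] := leP (l2norm (z + F j) ^+ 2) (l2norm z ^+ 2 + l2norm (F j) ^+ 2).
    by exists false; rewrite expr0 scale1r.
  by exists true; rewrite expr1 scaleN1r; lra.
have [sg Hsg] := IH (z + (-1) ^+ b *: F j) ur.
exists (fun i => if i == j then b else sg i); rewrite !big_cons eqxx addrA.
rewrite (eq_big_seq (fun i => (-1) ^+ sg i *: F i)); last first.
  by move=> i ir; case: eqP => // ij; move: jr; rewrite -ij ir.
by apply: (le_trans Hsg); rewrite addrA lerD2r.
Qed.

Definition ket (x0 : X) : ell2 R X.
Proof.
apply: (@Ell2 R X (fun x => (x == x0)%:R)); apply/sqsummableP.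
rewrite /sqsum (@esum_seq _ _ _ [:: x0])//; first exact: ltry.
  by move=> x; exact: sqr_ge0.
by move=> x; rewrite inE => /negbTE ->; rewrite normc0 expr0n.
Defined.

Lemma l2norm_ket x0 : l2norm (ket x0) = 1.
Proof.
apply/eqP; rewrite -(@eqrXn2 _ 2)// ?l2norm_ge0// expr1n.
rewrite (@sqr_l2norm_seq _ [:: x0])//=; last by move=> x; rewrite inE => /negbTE ->.
by rewrite big_seq1 /= eqxx normc1 expr1n.
Qed.

End Ell2Basics.

(** * Bounded operators and discreteness *)

Section Operators.
Context (R : realType) (X : choiceType).
Implicit Types (a b : bounded_op R X) (v w : ell2 R X).

Lemma opnorm_ge0 a : 0 <= opnorm a.
Proof.
have [K K0 aK] := op_bounded_ge0 a; apply: ub_le_sup.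
  exists K => _ [w /= w1 <-]; apply: (le_trans (aK w)).
  by rewrite ler_piMr.
by exists 0; rewrite /= ?linear0 l2norm0.
Qed.

Lemma opnorm_adherent a (e : R) : 0 < e ->
  exists s v, [/\ uniq s, forall x, x \notin s -> v x = 0, l2norm v <= 1 &
    opnorm a - e < l2norm (a v)].
Proof.
move=> e0; have := opnorm_ge0 a; set n := opnorm a => n0.
have [_ [v /= v1 <-] av] : exists2 y,
    [set l2norm (a v) | v in [set v | l2norm v <= 1]] y & n - e / 2 < y.
  apply: sup_adherent; first lra.
  split; first by exists (l2norm (a 0)); exists 0; rewrite //= l2norm0.
  exists n => _ [w /= w1 <-]; apply: (le_trans (ler_opnorm a w)).
  by rewrite ler_piMr.
have d0 : 0 < e / 2 / (n + 1) by rewrite divr_gt0//; lra.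
have [s us vs] := restr_dense v d0.
exists s, (restr [set` s] v); split => //.
- by move=> x /negP xs; rewrite restrF.
- exact: le_trans (l2norm_restr_le _ _) v1.
have vE : v = restr [set` s] v + (v - restr [set` s] v) by rewrite addrC subrK.
have : l2norm (a (v - restr [set` s] v)) <= e / 2.
  apply: (le_trans (ler_opnorm a _)); rewrite -/n.
  apply: (@le_trans _ _ ((n + 1) * (e / 2 / (n + 1)))).
    by rewrite ler_pM ?l2norm_ge0//; lra.
  by rewrite mulrC mulfVK//; lra.
have := ler_l2normD (a (restr [set` s] v)) (a (v - restr [set` s] v)).
by rewrite -linearD -vE; lra.
Qed.

Lemma opnorm_le a (K : R) : 0 <= K ->
  (forall s v, uniq s -> (forall x, x \notin s -> v x = 0) ->
     l2norm (a v) <= K * l2norm v) -> opnorm a <= K.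
Proof.
move=> K0 aK; apply/ler_addgt0Pr => e e0.
have [s [v [us vs v1 av]]] := opnorm_adherent a e0.
have : l2norm (a v) <= K by rewrite (le_trans (aK s v us vs))// ler_piMr.
lra.
Qed.

End Operators.

Section BoundedGeometry.
Context (R : realType) (X : metricType R) (hX : bounded_geometry X).

Lemma ball_enumeration (r : R) : exists N (bs : X -> seq X), forall x,
  [/\ uniq (bs x), (size (bs x) <= N)%N & forall y, (y \in bs x) = (mdist x y <= r)].
Proof.
wlog r0 : r / 0 <= r => [wl|].
  have [/wl//|r0] := leP 0 r; exists 0%N, (fun=> [::]) => x; split => // y.
  by rewrite in_nil; apply/esym/negbTE; rewrite -ltNge (lt_le_trans r0)// mdist_ge0.
have [N HN] := hX r0; exists N, (fun x => finmap.enum_fset (fset_set (cball x r))).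
move=> x; split; [exact: finmap.fset_uniq|exact: geq_card_fset_set|move=> y].
have fin : finite_set (cball x r) by apply/finite_set_leP; exists N.
rewrite in_fset_set//; apply/idP/idP; last by move=> ?; rewrite inE.
by rewrite inE.
Qed.

(** Balls are finite, so each point has positive distance to the others; hence all
    functions on the space are continuous and all subsets are open. *)
Lemma nbhs_point (x : X) : nbhs x [set x].
Proof.
have [N [bs /(_ x) [_ _ bsE]]] := ball_enumeration 1.
suff [e e0 He] : exists2 e : R, 0 < e &
    forall y, y \in bs x -> y != x -> e <= mdist x y.
  apply/nbhs_ballP; exists (Num.min e 1); first by rewrite /= lt_min e0 ltr01.
  move=> y; rewrite ballEmdist /= lt_min => /andP[ye y1].
  apply/eqP; rewrite -[_ == _]negbK; apply/negP => yx.
  by have := He y; rewrite bsE (ltW y1) yx leNgt ye => /(_ isT isT).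
elim: (bs x) => [|z s [e e0 He]]; first by exists 1.
have [->|zx] := eqVneq z x.
  exists e => // y; rewrite inE => /orP[/eqP ->|/He//]; by rewrite eqxx.
exists (Num.min e (mdist x z)).
  by rewrite lt_min e0 mdist_gt0 eq_sym.
move=> y; rewrite inE ge_min => /orP[/eqP -> _|ys yx]; first by rewrite lexx orbT.
by rewrite He.
Qed.

Lemma continuous_discrete (T : topologicalType) (g : X -> T) : continuous g.
Proof.
move=> x B /nbhs_singleton Bgx; apply: filterS (nbhs_point x).
by move=> y ->.
Qed.

Lemma open_discrete (A : set X) : open A.
Proof. by rewrite openE => x Ax; apply: filterS (nbhs_point x) => y ->. Qed.

Definition discrete_bc (g : X -> R[i]) (K : R) (gK : forall x, normc (g x) <= K) :
  bounded_cont X.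
Proof. by apply: (@BoundedCont R X g); [exact: continuous_discrete|exists K]. Defined.

Lemma discrete_bcE g K (gK : forall x, normc (g x) <= K) :
  discrete_bc gK = g :> (X -> _).
Proof. by []. Qed.

End BoundedGeometry.

Lemma mul_opE (R : realType) (X : metricType R) (f : bounded_cont X)
  (v : ell2 R X) x : mul_op f v x = f x * v x.
Proof. by []. Qed.

Lemma commutatorE (R : realType) (X : metricType R) (f : bounded_cont X)
    (a : bounded_op R X) (v : ell2 R X) :
  commutator a f v = a (mul_op f v) - mul_op f (a v).
Proof. by []. Qed.

(** * Localisation on separated blocks *)

Lemma sum_gt0_ex (R : realDomainType) (I : eqType) (r : seq I) (F : I -> R) :
  0 < \sum_(i <- r) F i -> exists2 i, i \in r & 0 < F i.
Proof.
move=> F0; apply/hasP; rewrite -[has _ _]negbK -all_predC; apply/negP => /allP F_le.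
move: F0; rewrite ltNge => /negP; apply; rewrite big_seq.
by apply: sumr_le0 => i /F_le /=; rewrite -leNgt.
Qed.

Lemma sum_le_ex (R : realDomainType) (I : eqType) (r : seq I) (F G : I -> R) :
  r != [::] -> \sum_(i <- r) F i <= \sum_(i <- r) G i ->
  exists2 i, i \in r & F i <= G i.
Proof.
move=> r0 FG; apply/hasP; rewrite -[has _ _]negbK -all_predC; apply/negP => /allP G_lt.
move: FG; rewrite leNgt => /negP; apply; rewrite [ltLHS]big_seq [ltRHS]big_seq.
apply: ltr_sum => [|i /G_lt /=]; last by rewrite -ltNge.
by case: r r0 {G_lt} => //= j r _; rewrite mem_head.
Qed.

Section RealMultipliers.
Context (R : realType).

Lemma normc_real (t : R) : normc t%:C%C = `|t|.
Proof. by rewrite /normc /= expr0n addr0 sqrtr_sqr. Qed.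

Lemma normc_realM (t : R) z : normc (t%:C%C * z) = `|t| * normc z.
Proof. by rewrite normcM normc_real. Qed.

(** For [f] with values [1] and [-1] on the support of [w], the vector [b w] is
    [f (b (f w))] up to the commutator of [b] and [f]; so changing signs in [w] by a
    Lipschitz function hardly shortens [b w]. *)
Lemma sign_change_norm (X : metricType R) (x0 : X) (L d : R) (b : bounded_op R X)
    (f : bounded_cont X) (w : ell2 R X) :
  Commut L d b -> lipschitz_fun L f -> (forall x, normc (f x) <= 1) ->
  mul_op f (mul_op f w) = w ->
  l2norm (b w) - d * l2norm w <= l2norm (b (mul_op f w)).
Proof.
move=> Cb fL f1 ffw.
have mul_le v : l2norm (mul_op f v) <= l2norm v.
  rewrite -ler_sqr ?nnegrE ?l2norm_ge0// -lee_fin !sqr_l2norm.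
  by have := sqsum_mul_le v f1; rewrite expr1n mul1e.
have cf : opnorm (commutator b f) < d.
  apply: Cb => //; apply: ge_sup => [|_ [x _ <-]]; last exact: f1.
  by exists (normc (f x0)); exists x0.
have bwE : b w = mul_op f (b (mul_op f w)) + commutator b f (mul_op f w).
  by rewrite commutatorE ffw addrC subrK.
have : l2norm (commutator b f (mul_op f w)) <= d * l2norm w.
  apply: (le_trans (ler_opnorm _ _)); apply: ler_pM => //.
  - exact: opnorm_ge0.
  - exact: l2norm_ge0.
  - exact: ltW.
have := ler_l2normD (mul_op f (b (mul_op f w))) (commutator b f (mul_op f w)).
rewrite -bwE; have := mul_le (b (mul_op f w)); lra.
Qed.

(** Minus 1, this is an [L]-Lipschitz function with value [-1] on [E] and value [1] on
    the points at distance at least [2 / L] from [E]. *)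
Definition clipped_dist (X : metricType R) (L : R) (E : seq X) (x : X) : R :=
  \big[Num.min/2]_(y <- E) (L * mdist x y).

Section ClippedDist.
Context (X : metricType R) (L : R) (E : seq X) (L0 : 0 <= L).

Lemma clipped_dist_ge0 x : 0 <= clipped_dist L E x.
Proof.
rewrite /clipped_dist; elim/big_ind: _ => // [a b a0 b0|y _].
  by rewrite le_min a0 b0.
by rewrite mulr_ge0// mdist_ge0.
Qed.

Lemma clipped_dist_le2 x : clipped_dist L E x <= 2.
Proof.
rewrite /clipped_dist; elim: E => [|y s IH]; first by rewrite big_nil.
by rewrite big_cons ge_min IH orbT.
Qed.

Lemma clipped_dist_in x : x \in E -> clipped_dist L E x = 0.
Proof.
move=> xE; apply/eqP; rewrite eq_le clipped_dist_ge0 andbT.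
rewrite /clipped_dist; elim: E xE => // y s IH.
rewrite inE big_cons ge_min => /orP[/eqP ->|/IH ->]; last by rewrite orbT.
by rewrite mdistxx mulr0 lexx.
Qed.

Lemma clipped_dist_far x : (forall y, y \in E -> 2 <= L * mdist x y) ->
  clipped_dist L E x = 2.
Proof.
move=> far; apply/eqP; rewrite eq_le clipped_dist_le2/= /clipped_dist big_seq.
by elim/big_ind: _ => // a b a2 b2; rewrite le_min a2 b2.
Qed.

Lemma clipped_dist_lip x y :
  `|clipped_dist L E x - clipped_dist L E y| <= L * mdist x y.
Proof.
suff H u v : clipped_dist L E u - L * mdist u v <= clipped_dist L E v.
  have := H x y; have := H y x; rewrite [mdist y x]metric_sym.
  by rewrite ler_norml; lra.
elim: E => [|z s IH].
  by rewrite /clipped_dist !big_nil gerBl mulr_ge0// mdist_ge0.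
have consE t : clipped_dist L (z :: s) t = Num.min (L * mdist t z) (clipped_dist L s t).
  by rewrite /clipped_dist big_cons.
rewrite !consE le_min; apply/andP; split.
  rewrite lerBlDr ge_min -mulrDr addrC; apply/orP; left.
  by rewrite ler_wpM2l// metric_triangle.
by apply: le_trans IH; rewrite lerD2r ge_min lexx orbT.
Qed.

End ClippedDist.
End RealMultipliers.

Section BlockLocalisation.
Context (R : realType) (X : metricType R) (x0 : X) (hX : bounded_geometry X).

(** Give the blocks of [w] the signs that [greedy_signs] provides for their images
    under [b]. As the blocks are far apart, a Lipschitz function [f] realises these signs,
    and then the square of the norm of [b (f w)] is at most the sum of those of the
    [b wi], while it is nearly at least that of [b w]. So one of the blocks does as well
    as [w]. *)
Lemma block_localisation (I : eqType) (L d K : R) (b : bounded_op R X) (s : seq X)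
    (w : ell2 R X) (lab : X -> I) :
  0 < L -> 0 <= K -> Commut L d b ->
  uniq s -> (forall x, x \notin s -> w x = 0) -> w != 0 ->
  (forall x y, w x != 0 -> w y != 0 -> lab x != lab y -> 2 <= L * mdist x y) ->
  (K + d) * l2norm w <= l2norm (b w) ->
  exists i, let wi := restr [set x | lab x = i] w in
    wi != 0 /\ K * l2norm wi <= l2norm (b wi).
Proof.
move=> L0 K0 Cb us ws w0 sep bw.
pose wi i := restr [set x | lab x = i] w.
have wiE i x : wi i x = if lab x == i then w x else 0.
  by rewrite /wi /=; congr (if _ then _ else _); apply/asboolP/eqP.
pose r := undup (map lab [seq x <- s | w x != 0]).
have ur : uniq r by exact: undup_uniq.
have in_s x : w x != 0 -> x \in s.
  by move=> wx; rewrite -[_ \in _]negbK; apply: contra wx => /ws ->.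
have in_r x : w x != 0 -> lab x \in r.
  by move=> wx; rewrite mem_undup map_f// mem_filter wx in_s.
have sqr_wi i : l2norm (wi i) ^+ 2 = \sum_(x <- s) (if lab x == i then normc (w x) ^+ 2 else 0).
  rewrite (@sqr_l2norm_seq _ _ _ s us) => [|x xs]; last by rewrite wiE ws// if_same.
  by apply: eq_bigr => x _; rewrite wiE; case: ifP => // _; rewrite normc0 expr0n.
have pyth : \sum_(i <- r) l2norm (wi i) ^+ 2 = l2norm w ^+ 2.
  rewrite (@sqr_l2norm_seq _ _ w s us)// (eq_bigr _ (fun i _ => sqr_wi i)) exchange_big/=.
  apply: eq_bigr => x _; have [->|wx] := eqVneq (w x) 0.
    by rewrite normc0 expr0n/=; under eq_bigr do rewrite if_same; rewrite big1.
  rewrite (bigD1_seq (lab x)) ?in_r//= eqxx big1 ?addr0// => i /negbTE ix.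
  by rewrite eq_sym ix.
have [sg] := greedy_signs (fun i => b (wi i)) 0 ur.
rewrite l2norm0 expr0n/= !add0r.
pose E := [seq x <- s | (w x != 0) && sg (lab x)].
pose g x : R := clipped_dist L E x - 1.
have g1 x : normc (g x)%:C%C <= 1.
  rewrite normc_real ler_norml /g.
  by have := clipped_dist_ge0 E (ltW L0) x; have := clipped_dist_le2 L E x; lra.
have gE x : w x != 0 -> g x = (-1) ^+ sg (lab x).
  move=> wx; rewrite /g; have [sx|sx] := boolP (sg (lab x)).
    by rewrite clipped_dist_in ?mem_filter ?wx ?sx ?in_s ?ltW// expr1; lra.
  rewrite clipped_dist_far ?expr0; first by lra.
  move=> y; rewrite mem_filter => /andP[/andP[wy sy] _]; apply: sep => //.
  by apply: contra sx => /eqP ->.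
pose f := discrete_bc hX g1.
have fL : lipschitz_fun L f.
  move=> x y; rewrite discrete_bcE -rmorphB normc_real /g.
  rewrite (_ : _ - _ = clipped_dist L E x - clipped_dist L E y); last by ring.
  exact: clipped_dist_lip (ltW L0) _ _.
have ffw : mul_op f (mul_op f w) = w.
  apply/val_inj/funext => x; rewrite -[LHS]/(f x * (f x * w x)) -[RHS]/(w x).
  have [->|wx] := eqVneq (w x) 0; first by rewrite !mulr0.
  by rewrite discrete_bcE gE// rmorphXn rmorphN1 mulrA -expr2 sqrr_sign mul1r.
have fwE : mul_op f w = \sum_(i <- r) (-1) ^+ sg i *: wi i.
  apply/val_inj/funext => x; rewrite -[LHS]/(f x * w x) [RHS]ell2_sumE.
  have [wx|wx] := eqVneq (w x) 0.
    rewrite wx mulr0 big1// => i _; by rewrite ell2_scaleE wiE wx if_same mulr0.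
  rewrite (bigD1_seq (lab x)) ?in_r// big1.
    by rewrite ell2_scaleE wiE eqxx discrete_bcE gE// rmorphXn rmorphN1 [RHS]addr0.
  by move=> i /negbTE ix; rewrite ell2_scaleE wiE eq_sym ix mulr0.
have := sign_change_norm x0 Cb fL g1 ffw.
rewrite fwE linear_sum/=; under eq_bigr do rewrite linearZ/=.
set B := l2norm (\sum_(i <- r) _) => Bw Bsum.
have : \sum_(i <- r) (K * l2norm (wi i)) ^+ 2 <= \sum_(i <- r) l2norm (b (wi i)) ^+ 2.
  apply: le_trans Bsum; under eq_bigr do rewrite exprMn.
  rewrite -mulr_sumr pyth -exprMn ler_sqr ?nnegrE ?mulr_ge0 ?l2norm_ge0//.
  by move: Bw bw; rewrite mulrDl; lra.
move=> /sum_le_ex[|i ir].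
  apply: contra w0 => /eqP r0; apply/eqP/val_inj/funext => x /=.
  by apply/eqP; rewrite -[_ == _]negbK; apply/negP => /in_r; rewrite r0.
rewrite ler_sqr ?nnegrE ?mulr_ge0 ?l2norm_ge0// => Ki; exists i; split => //.
move: ir; rewrite mem_undup => /mapP[x]; rewrite mem_filter => /andP[wx _] ->.
apply: contra wx => /eqP wi0; have := wiE (lab x) x; rewrite eqxx => <-.
by rewrite /wi wi0.
Qed.

End BlockLocalisation.

(** * From sparsification to localisation *)

Section AtomicMeasure.
Context d (T : measurableType d) (R : realType) (s : seq T) (w : T -> {nonneg R}).

Definition atomic_measure : set T -> \bar R :=
  msum (fun k => mscale (w (nth point s k)) (dirac (nth point s k))) (size s).

HB.instance Definition _ := Measure.on atomic_measure.

Lemma atomic_measureE A :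
  atomic_measure A = (\sum_(x <- s) (w x)%:num * (x \in A)%:R)%:E.
Proof.
rewrite /atomic_measure /msum (big_nth point) big_mkord -sumEFin.
by apply: eq_bigr => k _; rewrite EFinM.
Qed.

Let atomic_measure_fin : fin_num_fun atomic_measure.
Proof. by move=> A mA; rewrite atomic_measureE. Qed.

HB.instance Definition _ :=
  Measure_isFinite.Build d T R atomic_measure atomic_measure_fin.

End AtomicMeasure.

Section SparsificationToLocalisation.
Context (R : realType) (X : pmetricType R).

(** Sparsification of an atomic measure; [lab] names the piece that contains a point. *)
Lemma sparsification_seq (c : R) (m : nat) : metric_sparsification X -> 0 < c < 1 ->
  exists2 S : R, 0 < S & forall (s : seq X) (w : X -> R), (forall x, 0 <= w x) ->
    exists (I : eqType) (Om : set X) (lab : X -> I),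
    [/\ forall x y, Om x -> Om y -> lab x != lab y -> m%:R <= mdist x y,
        forall x y, Om x -> Om y -> lab x = lab y -> mdist x y <= S &
        c * \sum_(x <- s) w x <= \sum_(x <- s) w x * (x \in Om)%:R].
Proof.
move=> spX c01; have [f _ /(_ m) Hf] := spX c c01.
exists ((f m)%:R + 1) => [|s w w0]; first by rewrite ltr_wpDl.
have [I [Om [tOm mOm sep bd mass]]] :=
  Hf (@atomic_measure _ (g_sigma_algebraType (@open X)) R s
        (fun x => NngNum (w0 x))).
(* the index type is arbitrary and may be empty, hence the option *)
pose lab x : option {classic I} :=
  if pselect (exists i, Om i x) is left h then Some (projT1 (cid h)) else None.
have labP x : (\bigcup_i Om i) x -> exists2 i, lab x = Some i & Om i x.
  move=> [i _ ix]; rewrite /lab; case: pselect => [h|[]]; last by exists i.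
  by case: cid => j jx /=; exists j.
exists (option {classic I}), (\bigcup_i Om i), lab; split.
- move=> x y /labP[i -> ix] /labP[j -> jy] ij.
  rewrite -lee_fin; apply: le_trans (sep i j _) _.
    by move=> eij; move: ij; rewrite eij eqxx.
  by apply: ereal_inf_lbound; exists (x, y).
- move=> x y /labP[i -> ix] /labP[j -> jy] [ij]; rewrite -ij in jy.
  apply: (@le_trans _ _ (f m)%:R); last by rewrite lerDl.
  by rewrite -lee_fin; apply: le_trans (bd i); apply: ereal_sup_ubound; exists (x, y).
- have massE := @atomic_measureE _ (g_sigma_algebraType (@open X)) R s
    (fun x => NngNum (w0 x)).
  move: mass; rewrite [X in (_ * X <= _)%E]massE [X in (_ <= X)%E]massE.
  rewrite -EFinM lee_fin.
  by under eq_bigr do rewrite in_setT mulr1.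
Qed.

(** Sparsify the measure with density [|v| ^+ 2], for a finitely supported [v] that
    nearly attains the norm of [b], and apply [block_localisation] to the part of [v] on
    the pieces. Three losses of [eps / 6] occur, for [v] against the norm, for cutting
    [v] down, and for the commutator. *)
Lemma sparsification_localises (hX : bounded_geometry X) (eps L M : R) :
  metric_sparsification X -> 0 < eps -> 0 < L -> 0 < M ->
  exists2 S : R, 0 < S & forall b : bounded_op R X, opnorm b <= M ->
    Commut L (eps / 6) b -> exists v : ell2 R X,
      [/\ l2norm v = 1, (diam (supp v) <= S%:E)%E & opnorm b - eps <= l2norm (b v)].
Proof.
move=> spX e0 L0 M0.
(* the proportion of the mass that may be lost: its square root, times the bound
   [M] on the norm, has to be at most [eps / 6] *)
pose e := Num.min (1 / 2) ((eps / (6 * M)) ^+ 2).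
have e0' : 0 < e by rewrite lt_min divr_gt0//= exprn_gt0// divr_gt0// mulr_gt0.
have e1 : e <= 1 / 2 by rewrite ge_min lexx.
have eM : M * Num.sqrt e <= eps / 6.
  have -> : eps / 6 = M * (eps / (6 * M)) by field; rewrite gt_eqF.
  rewrite ler_pM2l// -[leRHS]ger0_norm ?divr_ge0 ?mulr_ge0 ?(ltW e0) ?(ltW M0)//.
  by rewrite -sqrtr_sqr ler_wsqrtr// ge_min lexx orbT.
have c01 : 0 < 1 - e < 1 by apply/andP; split; lra.
(* the separation at which a function with values [1] and [-1] is [L]-Lipschitz *)
pose m := (Num.trunc (2 / L)).+1.
have mL : 2 <= L * m%:R.
  by rewrite -ler_pdivrMl// mulrC ltW// truncnS_gt.
have [S S0 HS] := sparsification_seq m spX c01.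
exists S => // b bM Cb; set n := opnorm b in bM *.
have [ne|ne] := leP n eps.
  exists (ket R point); split; first exact: l2norm_ket.
    apply: ge_ereal_sup => _ [[x y] [/= + +] <-].
    rewrite /supp /= !pnatr_eq0 !eqb0 !negbK => /eqP -> /eqP ->.
    by rewrite mdistxx lee_fin ltW.
  by apply: (@le_trans _ _ 0); [lra|exact: l2norm_ge0].
have e6 : 0 < eps / 6 by lra.
have [s [v [us vs v1]]] := opnorm_adherent b e6; rewrite -/n => bv.
have [|I [Om [lab [sep bd mass]]]] := HS s (fun x => normc (v x) ^+ 2).
  by move=> x; exact: sqr_ge0.
pose w := restr Om v.
have wE x : w x = if x \in Om then v x else 0.
  by rewrite /w /=; congr (if _ then _ else _); apply/asboolP/idP; rewrite inE.
have ws x : x \notin s -> w x = 0 by move=> xs; rewrite wE vs// if_same.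
have wOm x : w x != 0 -> Om x.
  by rewrite wE; case: ifPn => [|_]; rewrite ?inE// eqxx.
have vw : l2norm (v - w) <= Num.sqrt e.
  rewrite -[leLHS]ger0_norm ?l2norm_ge0// -sqrtr_sqr ler_wsqrtr//.
  have := sqr_l2norm_restr Om v; rewrite -/w.
  have : (1 - e) * l2norm v ^+ 2 <= l2norm w ^+ 2.
    rewrite (sqr_l2norm_seq us vs) (sqr_l2norm_seq us ws).
    apply: (le_trans mass); rewrite le_eqVlt; apply/orP; left; apply/eqP.
    apply: eq_bigr => x _; rewrite wE; case: ifP; rewrite ?mulr1// mulr0.
    by rewrite normc0 expr0n.
  have : e * l2norm v ^+ 2 <= e.
    by rewrite ler_piMr ?(ltW e0')// exprn_ile1// l2norm_ge0.
  lra.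
have w1 : l2norm w <= 1 by apply: le_trans v1; exact: l2norm_restr_le.
have bw : n - eps / 3 <= l2norm (b w).
  have : l2norm (b (v - w)) <= eps / 6.
    apply: le_trans (ler_opnorm _ _) _; apply: le_trans eM.
    by apply: ler_pM => //; rewrite ?opnorm_ge0 ?l2norm_ge0.
  have := ler_l2normD (b w) (b (v - w)).
  by rewrite -linearD (addrC w) subrK; lra.
have w0 : w != 0.
  apply/eqP => w0; move: bw; rewrite w0 linear0 l2norm0; lra.
have [|x y wx wy xy| |i] := @block_localisation R X point hX I L (eps / 6) (n - eps) b s w lab
  L0 _ Cb us ws w0.
- lra.
- by apply: (le_trans mL); rewrite ler_pM2l// sep//; exact: wOm.
- have := l2norm_ge0 w; have : (n - eps + eps / 6) * l2norm w <= n - eps + eps / 6.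
    by rewrite ler_piMr//; lra.
  lra.
set wi := restr _ w => /= -[wi0 bwi].
have nwi : 0 < l2norm wi.
  by rewrite lt_neqAle l2norm_ge0 andbT eq_sym; apply: contra wi0 => /eqP/l2norm_eq0 ->.
have nV : normc ((l2norm wi)^-1)%:C%C = (l2norm wi)^-1.
  by rewrite normc_real ger0_norm// invr_ge0 ltW.
exists (((l2norm wi)^-1)%:C%C *: wi); split.
- by rewrite l2normZ nV mulVf// gt_eqF.
- apply: ge_ereal_sup => _ [[x y] [/= + +] <-]; rewrite /supp /=.
  rewrite !mulf_eq0 !negb_or => /andP[_ +] /andP[_ +].
  case: asboolP => [xi wx|]; last by rewrite eqxx.
  case: asboolP => [yi wy|]; last by rewrite eqxx.
  by rewrite lee_fin; apply: bd; [exact: wOm|exact: wOm|rewrite xi yi].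
- by rewrite linearZ/= l2normZ nV mulrC ler_pdivlMr.
Qed.

End SparsificationToLocalisation.

(** * Commutators of operators of finite propagation *)

Lemma sqr_sum_le (R : realFieldType) (I : Type) (r : seq I) (c : I -> R) :
  (\sum_(i <- r) c i) ^+ 2 <= (size r)%:R * \sum_(i <- r) c i ^+ 2.
Proof.
have dbl : (\sum_(i <- r) c i) ^+ 2 <=
    \sum_(i <- r) \sum_(j <- r) (c i ^+ 2 / 2 + c j ^+ 2 / 2).
  rewrite expr2 big_distrlr /=; apply: ler_sum => i _; apply: ler_sum => j _.
  have := sqr_ge0 (c i - c j); rewrite sqrrB; lra.
apply: (le_trans dbl).
under eq_bigr do rewrite big_split/= -mulr_suml big_const_seq count_predT iter_addr_0.
rewrite big_split/= big_const_seq count_predT iter_addr_0 -!mulr_suml sumrMnl.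
have half (n S : R) : n * S / 2 + n * (S / 2) = n * S by field.
by rewrite -[X in X / 2 + _]mulr_natl -[X in _ + X]mulr_natl half.
Qed.

Section FinitePropagation.
Context (R : realType) (X : metricType R) (hX : bounded_geometry X).

Lemma op_scaleE (a : bounded_op R X) c (u : ell2 R X) x : a (c *: u) x = c * a u x.
Proof. by rewrite linearZ. Qed.

Lemma indicator_normc_le1 (x y : X) : normc ((y == x)%:R : R[i]) <= 1.
Proof. by case: eqP => _; rewrite ?normc1 ?normc0 ?ler01. Qed.

Lemma propagation_entry (r : R) (a : bounded_op R X) (x y : X) :
  propagation_le r a -> r < mdist x y -> a (ket R y) x = 0.
Proof.
move=> pa rxy.
pose f z := discrete_bc hX (indicator_normc_le1 z).
have suppf z : supp (f z) = [set z].
  apply/seteqP; split => t; rewrite /supp /=; last by move=> ->; rewrite eqxx oner_eq0.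
  by case: (t =P z) => // _; rewrite eqxx.
have dist_xy : set_dist (supp (f x)) (supp (f y)) = (mdist x y)%:E.
  rewrite !suppf /set_dist; apply/eqP; rewrite eq_le; apply/andP; split.
    by apply: ereal_inf_lbound; exists (x, y).
  by apply: le_ereal_inf_tmp => _ [[x' y'] [/= -> ->] <-].
have f_ket : mul_op (f y) (ket R y) = ket R y.
  apply/val_inj/funext => z; rewrite -[LHS]/((z == y)%:R * (z == y)%:R) -[RHS]/((z == y)%:R).
  by case: eqP => _; rewrite ?mul1r ?mul0r.
have H := pa (f x) (f y) _ (ket R y).
have : mul_op (f x) (a (mul_op (f y) (ket R y))) = 0.
  by apply: H; rewrite dist_xy lte_fin.
rewrite f_ket => /(congr1 (fun v : ell2 R X => v x)).
by rewrite mul_opE discrete_bcE eqxx mul1r.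
Qed.

Lemma ket_decomposition (v : ell2 R X) (s : seq X) : uniq s ->
  (forall x, x \notin s -> v x = 0) -> v = \sum_(y <- s) v y *: ket R y.
Proof.
move=> us vs; apply/val_inj/funext => x; rewrite [RHS]ell2_sumE.
under eq_bigr do rewrite ell2_scaleE.
have [xs|xs] := boolP (x \in s); last first.
  rewrite -[LHS]/(v x) vs// big_seq big1// => y ys /=.
  by case: eqP ys => [<-|]; rewrite ?(negbTE xs)// mulr0.
rewrite (bigD1_seq x)//= eqxx mulr1 big1 ?addr0// => y yx.
by rewrite eq_sym (negbTE yx) mulr0.
Qed.

(** Schur's test: the matrix of the commutator has at most [N] nonzero entries in each
    row and column, where [N] bounds the cardinals of the balls of radius [r], and these
    entries are at most [L * r]. *)
Lemma propagation_commutator (r : R) : 0 < r -> exists N : nat,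
  forall (L : R) (a : bounded_op R X) (f : bounded_cont X), 0 < L ->
    propagation_le r a -> opnorm a = 1 -> lipschitz_fun L f ->
    opnorm (commutator a f) <= L * r * N%:R.
Proof.
move=> r0; have [N [bs bsP]] := ball_enumeration hX r; exists N.
move=> L a f L0 pa a1 fL; have Lr0 : 0 <= L * r by rewrite mulr_ge0// ltW.
have near_size (s : seq X) x : uniq s -> (size [seq y <- s | (mdist x y <= r)%R] <= N)%N.
  move=> us; have [ub bN bE] := bsP x; apply: leq_trans bN.
  apply: uniq_leq_size; first exact: filter_uniq.
  by move=> y; rewrite mem_filter bE => /andP[].
apply: opnorm_le => [|s v us vs]; first by rewrite mulr_ge0.
apply: l2norm_le_sum => [|t ut]; first by rewrite !mulr_ge0// ?l2norm_ge0// ltW.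
pose nb x := [seq y <- s | mdist x y <= r].
have entry x : normc (commutator a f v x) <= L * r * \sum_(y <- nb x) normc (v y).
  have -> : commutator a f v x = \sum_(y <- s) (f y - f x) * (v y * a (ket R y) x).
    have fv : mul_op f v = \sum_(y <- s) (f y * v y) *: ket R y.
      rewrite {1}(ket_decomposition us vs) linear_sum/=; apply: eq_bigr => y _.
      apply/val_inj/funext => z; rewrite -[LHS]/(f z * (v y * ket R y z)).
      rewrite -[RHS]/(f y * v y * ket R y z) /=.
      by case: eqP => [->|_]; [ring|rewrite !mulr0].
    rewrite commutatorE ell2_subE mul_opE fv.
    rewrite [in f x * _](ket_decomposition us vs) !linear_sum/= !ell2_sumE.
    rewrite mulr_sumr -sumrB; apply: eq_bigr => y _.
    rewrite !op_scaleE; move: (a (ket R y) x) (f y) (f x) (v y) => z s1 s2 s3.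
    by ring.
  have le_sum_normc (F : X -> R[i]) (q : seq X) :
      normc (\sum_(y <- q) F y) <= \sum_(y <- q) normc (F y).
    elim: q => [|y q IH]; first by rewrite !big_nil normc0.
    by rewrite !big_cons (le_trans (le_normcD _ _))// lerD2l.
  apply: (le_trans (le_sum_normc _ _)); rewrite big_filter mulr_sumr [leRHS]big_mkcond/=.
  apply: ler_sum => y _; rewrite !normcM; have [xy|xy] := leP (mdist x y) r; last first.
    by rewrite (propagation_entry pa xy) normc0 !mulr0.
  apply: ler_pM; rewrite ?normc_ge0 ?mulr_ge0 ?normc_ge0//.
    by apply: le_trans (fL y x) _; rewrite ler_pM2l// metric_sym.
  rewrite ler_piMr ?normc_ge0//; apply: le_trans (normc_le_l2norm _ _) _.
  by apply: le_trans (ler_opnorm _ _) _; rewrite a1 l2norm_ket mulr1.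
apply: (@le_trans _ _ (\sum_(x <- t) (L * r) ^+ 2 *
    (N%:R * \sum_(y <- s) (if mdist x y <= r then normc (v y) ^+ 2 else 0)))).
  apply: ler_sum => x _; apply: (@le_trans _ _ ((L * r * \sum_(y <- nb x) normc (v y)) ^+ 2)).
    by rewrite ler_sqr ?nnegrE ?normc_ge0// (le_trans _ (entry x))// normc_ge0.
  rewrite exprMn ler_wpM2l ?sqr_ge0//; apply: (le_trans (sqr_sum_le _ _)).
  rewrite big_filter big_mkcond/= ler_wpM2r ?ler_nat ?near_size//.
  by apply: sumr_ge0 => y _; case: ifP => // _; exact: sqr_ge0.
rewrite -mulr_sumr -mulr_sumr exchange_big/= !exprMn -!mulrA !ler_wpM2l ?(ltW L0) ?(ltW r0)//.
rewrite (sqr_l2norm_seq us vs) mulr_sumr.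
apply: ler_sum => y _; rewrite -big_mkcond/= big_const_seq iter_addr_0 -[leLHS]mulr_natl.
rewrite ler_wpM2r ?sqr_ge0// ler_nat; apply: leq_trans (near_size t y ut).
by rewrite size_filter sub_count// => x /=; rewrite metric_sym.
Qed.

Lemma propagation_Commut (r eps : R) : 0 < r -> 0 < eps -> exists2 L : R, 0 < L &
  forall a : bounded_op R X, propagation_le r a -> opnorm a = 1 -> Commut L eps a.
Proof.
move=> r0 eps0; have [N HN] := propagation_commutator r0.
pose L := eps / (2 * (r * N.+1%:R)).
have rN : 0 < r * N.+1%:R by rewrite mulr_gt0// ltr0n.
have L0 : 0 < L by rewrite divr_gt0// mulr_gt0.
exists L => // a pa a1 f _ fL; apply: le_lt_trans (HN L a f L0 pa a1 fL) _.
apply: (@le_lt_trans _ _ (L * (r * N.+1%:R))).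
  by rewrite -mulrA ler_pM2l// ler_pM2l// ler_nat.
have -> : L * (r * N.+1%:R) = eps / 2 by rewrite /L; field; rewrite !gt_eqF ?ltr0n.
lra.
Qed.

End FinitePropagation.

(** * Partitions of unity with small l1 variation *)

Section PowerInequalities.
Context (R : realType) (p : R) (p1 : 1 <= p).
Implicit Types a b t : R.

Let p0 : 0 < p. Proof. exact: lt_le_trans p1. Qed.

Lemma powR_mono a b : 0 <= a -> a <= b -> a `^ p <= b `^ p.
Proof.
move=> a0 ab; apply: ge0_ler_powR; rewrite ?nnegrE ?(ltW p0)//.
exact: le_trans ab.
Qed.

Lemma powR_inv_pow a : 0 <= a -> (a `^ p^-1) `^ p = a.
Proof. by move=> a0; rewrite -powRrM mulVf ?powRr1// gt_eqF. Qed.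

(** An elementary substitute for the inequality of Hoelder: for [b <= a], either [b] is
    at least [t `^ p^-1 * a], and then the difference of the powers is small relative to
    them, or [a - b] is comparable with [a]. *)
Lemma powR_dist_le t a b : 0 < t < 1 -> 0 <= a -> 0 <= b ->
  `|a `^ p - b `^ p| <= (1 - t) * (a `^ p + b `^ p) +
     ((1 - t `^ p^-1)^-1 * `|a - b|) `^ p.
Proof.
move=> /andP[t0 t1]; wlog ba : a b / b <= a => [wl a0 b0|a0 b0].
  have [ab|/ltW ab] := leP b a; first exact: wl.
  by rewrite distrC [a `^ p + _]addrC [`|a - b|]distrC; exact: wl.
have pba := powR_mono b0 ba.
have a_ge0 := powR_ge0 a p; have b_ge0 := powR_ge0 b p.
set u := t `^ p^-1; have u1 : u < 1.
  rewrite ltNge; apply/negP => u1; have : 1 `^ p <= u `^ p by exact: powR_mono.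
  by rewrite powR1 powR_inv_pow ?(ltW t0)// leNgt t1.
rewrite !ger0_norm ?subr_ge0//; have [uab|uab] := leP (u * a) b.
  have : (u * a) `^ p <= b `^ p by apply: powR_mono => //; rewrite mulr_ge0// powR_ge0.
  rewrite powRM ?powR_ge0// powR_inv_pow ?(ltW t0)//.
  have : 0 <= ((1 - u)^-1 * (a - b)) `^ p by exact: powR_ge0.
  have : 0 <= (1 - t) * b `^ p by rewrite mulr_ge0//; lra.
  lra.
have : a `^ p <= ((1 - u)^-1 * (a - b)) `^ p.
  apply: powR_mono => //; rewrite mulrC ler_pdivlMr ?subr_gt0//.
  by rewrite mulrBr mulr1 lerD2l lerN2 mulrC ltW.
have : 0 <= (1 - t) * (a `^ p + b `^ p) by rewrite mulr_ge0 ?(addr_ge0 a_ge0)//; lra.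
lra.
Qed.

Lemma powR_sub_le a b : 0 <= b -> b <= a -> (a - b) `^ p + b `^ p <= a `^ p.
Proof.
move=> b0 ba; have [a0|a0] := eqVneq a 0.
  have -> : b = 0 by lra.
  by rewrite a0 subr0 powR0 ?gt_eqF// addr0.
have {}a0 : 0 < a by rewrite lt_neqAle eq_sym a0; lra.
have part s : 0 <= s -> s <= a -> s `^ p <= s / a * a `^ p.
  move=> s0 sa; have [->|sn0] := eqVneq s 0; first by rewrite powR0 ?gt_eqF// !mul0r.
  have -> : s `^ p = (s / a) `^ p * a `^ p.
    by rewrite -powRM ?divr_ge0 ?(ltW a0)// mulfVK// gt_eqF.
  rewrite ler_wpM2r ?powR_ge0//; apply: ge1r_powR => //.
  rewrite divr_gt0//=; first by rewrite ler_pdivrMr// mul1r.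
  by rewrite lt_neqAle eq_sym sn0.
apply: le_trans (lerD (part (a - b) _ _) (part b _ _)) _; [lra..|].
by rewrite -mulrDl -mulrDl subrK divff ?gt_eqF// mul1r.
Qed.

(** Taking [p]-th roots turns small l1 variation into small variation of exponent
    [p]. *)
Lemma powR_root_dist a b : 0 <= a -> 0 <= b ->
  `|a `^ p^-1 - b `^ p^-1| `^ p <= `|a - b|.
Proof.
wlog ba : a b / b <= a => [wl a0 b0|a0 b0].
  have [ab|/ltW ab] := leP b a; first exact: wl.
  by rewrite distrC [`|a - b|]distrC; exact: wl.
have : b `^ p^-1 <= a `^ p^-1.
  by apply: ge0_ler_powR; rewrite ?nnegrE// invr_ge0 ltW.
move=> rba; rewrite !ger0_norm ?subr_ge0//.
have := powR_sub_le (powR_ge0 _ _) rba; rewrite !powR_inv_pow//; lra.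
Qed.

End PowerInequalities.

Lemma card_le_size (T : eqType) (A : set T) (s : seq T) (M : nat) :
  A `<=` [set` s] -> (size s <= M)%N -> (A #<= `I_M)%card.
Proof.
case: s => [|x0 s] As sM.
  have -> : A = set0 by rewrite -subset0 => x /As.
  exact: card_ge0.
apply: card_le_trans (card_image_le (nth x0 (x0 :: s)) `I_M).
apply: subset_card_le => x /As xs; exists (index x (x0 :: s)); last exact: nth_index.
by apply: leq_trans sM; rewrite index_mem.
Qed.

Section L1Partitions.
Context (R : realType) (X : metricType R) (p : R) (p1 : 1 <= p).

(** The [p]-th powers of a partition of unity with exponent [p]. *)
Lemma property_A_l1 (r e : R) : property_A X p -> 0 < r -> 0 < e ->
  exists (S : R) (I : choiceType) (psi : I -> X -> R),
  [/\ forall i x, 0 <= psi i x,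
      forall i x y, psi i x != 0 -> psi i y != 0 -> mdist x y <= S,
      forall x, \esum_(i in [set: I]) (psi i x)%:E = 1%E &
      forall x y (J : seq I), uniq J -> mdist x y <= r ->
        \sum_(i <- J) `|psi i x - psi i y| <= e].
Proof.
move=> A r0; wlog e1 : e / e <= 1 => [wl e0|e0].
  have [||S [I [psi [psi0 sup one var]]]] := wl (Num.min e 1).
  - by rewrite ge_min lexx orbT.
  - by rewrite lt_min e0 ltr01.
  exists S, I, psi; split => // x y J uJ xy.
  by apply: le_trans (var _ _ _ uJ xy) _; rewrite ge_min lexx.
have p0 : 0 < p by exact: lt_le_trans p1.
pose t := 1 - e / 4; have t01 : 0 < t < 1 by apply/andP; split; rewrite /t; lra.
pose h := 1 - t `^ p^-1.
have h0 : 0 < h.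
  rewrite subr_gt0 ltNge; apply/negP => u1.
  have : 1 `^ p <= (t `^ p^-1) `^ p by exact: powR_mono.
  by rewrite powR1 powR_inv_pow//; case/andP: t01; lra.
have [|I [phi [[phi01 bd _ one] var]]] := A r (h * (e / 2) `^ p^-1) r0.
  by rewrite mulr_gt0// powR_gt0// divr_gt0.
have phi0 i x : 0 <= phi i x by case/andP: (phi01 i x).
exists (fine (ereal_sup (range (fun i => diam (supp (phi i)))))), I,
  (fun i x => phi i x `^ p).
split => //= [i x|i x y px py|x y J uJ xy].
- exact: powR_ge0.
- have xy : ((mdist x y)%:E <= ereal_sup (range (fun i => diam (supp (phi i)))))%E.
    apply: (@le_trans _ _ (diam (supp (phi i)))); last first.
      by apply: ereal_sup_ubound; exists i.
    apply: ereal_sup_ubound; exists (x, y) => //; split; rewrite /supp /=.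
      by apply: contra px => /eqP ->; rewrite powR0// gt_eqF.
    by apply: contra py => /eqP ->; rewrite powR0// gt_eqF.
  rewrite -lee_fin fineK// fin_numE gt_eqF ?lt_eqF//.
  exact: lt_le_trans (ltNyr _) xy.
have sum1 z : \sum_(i <- J) phi i z `^ p <= 1.
  by rewrite -lee_fin; apply: le_trans (sum_le_esum _ uJ) _; rewrite one.
have sumv : \sum_(i <- J) `|phi i x - phi i y| `^ p <= h `^ p * (e / 2).
  rewrite -lee_fin; apply: le_trans (sum_le_esum _ uJ) _.
  apply: le_trans (ltW (var x y xy)) _; rewrite lee_fin.
  by rewrite (@powRM _ h) ?powR_ge0 ?(ltW h0)// powR_inv_pow//; lra.
apply: (@le_trans _ _ (\sum_(i <- J) ((1 - t) * (phi i x `^ p + phi i y `^ p) +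
     (h^-1) `^ p * `|phi i x - phi i y| `^ p))).
  apply: ler_sum => i _; rewrite -powRM ?invr_ge0 ?(ltW h0)//.
  exact: powR_dist_le.
rewrite big_split/= -!mulr_sumr big_split/=.
have -> : 1 - t = e / 4 by rewrite /t; lra.
have bound1 : e / 4 * (\sum_(i <- J) phi i x `^ p + \sum_(i <- J) phi i y `^ p) <= e / 4 * (1 + 1).
  by rewrite ler_wpM2l ?lerD//; lra.
have bound2 := ler_wpM2l (powR_ge0 h^-1 p) sumv.
have hh : h^-1 `^ p * (h `^ p * (e / 2)) = e / 2.
  by rewrite mulrA -powRM ?invr_ge0 ?(ltW h0)// mulVf ?gt_eqF// powR1 mul1r.
by rewrite hh in bound2; lra.
Qed.

Lemma l1_property_A :
  (forall r e : R, 0 < r -> 0 < e ->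
   exists (S : R) (I : choiceType) (M : nat) (psi : I -> X -> R) (J : X -> seq I),
  [/\ forall i x, 0 <= psi i x,
      forall i x y, psi i x != 0 -> psi i y != 0 -> mdist x y <= S,
      forall x, [/\ uniq (J x), (size (J x) <= M)%N &
        forall i, i \notin J x -> psi i x = 0],
      forall x, \sum_(i <- J x) psi i x = 1 &
      forall x y (s : seq I), uniq s -> mdist x y <= r ->
        \sum_(i <- s) `|psi i x - psi i y| <= e]) -> property_A X p.
Proof.
move=> H r e r0 e0; have p0 : 0 < p by exact: lt_le_trans p1.
have ep0 : 0 < e `^ p by exact: powR_gt0.
have [|S [I [M [psi [J [psi0 bd supJ one var]]]]]] := H r (e `^ p / 2) r0.
  by rewrite divr_gt0.
have root_eq0 a : (a `^ p^-1 != 0) -> a != 0.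
  by apply: contra => /eqP ->; rewrite powR0// invr_eq0 gt_eqF.
exists I, (fun i x => psi i x `^ p^-1); split; last first.
  move=> x y xy; apply: (@le_lt_trans _ _ (e `^ p / 2)%:E); last first.
    by rewrite lte_fin; lra.
  apply: esum_le => s us; rewrite lee_fin; apply: le_trans (var x y s us xy).
  by apply: ler_sum => i _; exact: powR_root_dist.
split.
- move=> i x; rewrite powR_ge0/=; have [us sM s0] := supJ x.
  have psi_le1 : psi i x <= 1.
    have [iJ|/s0 ->//] := boolP (i \in J x).
    by rewrite -(one x) (bigD1_seq i)//= lerDl sumr_ge0.
  have <- : 1 `^ p^-1 = 1 by rewrite powR1.
  by apply: ge0_ler_powR; rewrite ?nnegrE ?invr_ge0 ?(ltW p0).
- apply: (@le_lt_trans _ _ (S%:E)); last exact: ltry.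
  apply: ge_ereal_sup => _ [i _ <-]; apply: ge_ereal_sup => _ [[x y] [/= px py] <-].
  by rewrite lee_fin; apply: (bd i); exact: root_eq0.
- exists M => x; have [us sM s0] := supJ x.
  apply: card_le_size sM => i; rewrite /supp /= => /root_eq0 px.
  by rewrite -[_ \in _]negbK; apply: contra px => /s0 ->.
- move=> x; have [us sM s0] := supJ x.
  rewrite (@esum_seq _ _ _ (J x))// => [|i|i /s0 ->]; last 2 first.
  + exact: powR_ge0.
  + by rewrite powR_inv_pow.
  by rewrite -(one x); congr EFin; apply: eq_bigr => i _; rewrite powR_inv_pow.
Qed.

End L1Partitions.

(** * From Property A to sparsification *)

Lemma ltn_count (T : eqType) (P Q : pred T) (s : seq T) z :
  (forall x, Q x -> P x) -> z \in s -> P z -> ~~ Q z -> (count Q s < count P s)%N.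
Proof.
move=> QP + Pz Qz; elim: s => //= x s IH; rewrite inE => /orP[/eqP <-|zs].
  by rewrite Pz (negbTE Qz) add0n add1n ltnS sub_count.
by rewrite -addnS leq_add ?IH//; case: (Q x) (QP x) => // ->.
Qed.

Section LayerCake.
Context (R : realFieldType) (X : eqType) (Y : seq X).
Variables (mu : X -> R) (w : X -> X -> R) (a : R).

(** With [w x y = mu x] for close [x] and [y] and [0] otherwise, the value on the
    indicator of [E] is at most [a] times the mass of [E], less the mass of the outer
    boundary of [E]. *)
Definition net_mass (h : X -> R) : R :=
  a * (\sum_(x <- Y) mu x * h x) -
  \sum_(x <- Y) \sum_(y <- Y) w x y * `|h x - h y|.

(** Subtracting from [h] its least positive value [m] on [Y] splits [h] into [m] times
    the indicator of its support and a function with smaller support; [net_mass] is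
    additive for this splitting. *)
Lemma layer_cake (h : X -> R) : (forall x, 0 <= h x) -> 0 < net_mass h ->
  exists E : pred X, (forall x, E x -> h x != 0) /\
    0 < net_mass (fun x => (E x)%:R).
Proof.
have [n] := ubnP (count (fun x => h x != 0) Y).
elim: n h => // n IH h hn h0 net_h.
have [m m0 mE] : exists2 m, 0 < m &
    (exists2 x, x \in Y & h x = m) /\ {in Y, forall x, h x != 0 -> m <= h x}.
  have : has (fun x => h x != 0) Y.
    apply: contraLR net_h => /hasPn hY; have {}hY : {in Y, forall x, h x = 0}.
      by move=> x /hY; rewrite negbK => /eqP.
    rewrite /net_mass big_seq big1 => [|x /hY ->]; last by rewrite mulr0.
    rewrite big_seq big1 ?mulr0 ?subrr ?ltxx// => x /hY ->.
    by rewrite big_seq big1// => y /hY ->; rewrite subrr normr0 mulr0.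
  elim: (Y) => //= z s IHs; have [hz /= hs|hz _] := eqVneq (h z) 0.
    have [m m0 [[x xs hx] mh]] := IHs hs; exists m => //; split.
      by exists x; rewrite // inE xs orbT.
    move=> y; rewrite inE => /orP[/eqP ->|/mh//]; by rewrite hz eqxx.
  have z0 : 0 < h z by rewrite lt_neqAle eq_sym hz h0.
  have [/IHs[m m0 [[x xs hx] mh]]|/hasPn hs] := boolP (has (fun x => h x != 0) s).
    have [mz|zm] := leP m (h z).
      exists m => //; split; first by exists x; rewrite // inE xs orbT.
      by move=> y; rewrite inE => /orP[/eqP -> //|/mh].
    exists (h z) => //; split; first by exists z; rewrite // mem_head.
    move=> y; rewrite inE => /orP[/eqP -> //|/mh{}mh /mh]; apply: le_trans.
    exact: ltW.
  exists (h z) => //; split; first by exists z; rewrite // mem_head.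
  by move=> y; rewrite inE => /orP[/eqP -> //|/hs /negP].
case: mE => [[z zY hz] mh].
pose E x := h x != 0; pose h' x := if E x && (x \in Y) then h x - m else 0.
have hE : {in Y, forall x, h x = m * (E x)%:R + h' x}.
  move=> x xY; rewrite /h' /E xY andbT; case: eqP => [->|_] /=.
    by rewrite mulr0 add0r.
  by rewrite mulr1 addrC subrK.
have dE : {in Y &, forall x y,
    `|h x - h y| = m * `|(E x)%:R - (E y)%:R| + `|h' x - h' y|}.
  move=> x y xY yY; rewrite /h' /E xY yY !andbT.
  have [hx|hx] := eqVneq (h x) 0; have [hy|hy] := eqVneq (h y) 0 => /=.
  - by rewrite hx hy !subrr !normr0 mulr0 addr0.
  - have := mh y yY hy; rewrite hx !sub0r !normrN normr1 mulr1 => my.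
    by rewrite !ger0_norm ?subr_ge0 ?h0//; ring.
  - have := mh x xY hx; rewrite hy !subr0 normr1 mulr1 => mx.
    by rewrite !ger0_norm ?subr_ge0 ?h0//; ring.
  - rewrite subrr normr0 mulr0 add0r; congr `|_|; ring.
have split_net : net_mass h = m * net_mass (fun x => (E x)%:R) + net_mass h'.
  have -> : net_mass h = a * (\sum_(x <- Y) (m * (mu x * (E x)%:R) + mu x * h' x)) -
      \sum_(x <- Y) \sum_(y <- Y)
         (m * (w x y * `|(E x)%:R - (E y)%:R|) + w x y * `|h' x - h' y|).
    rewrite /net_mass; congr (_ * _ - _).
      by apply: eq_big_seq => x /hE {1}->; ring.
    apply: eq_big_seq => x xY; apply: eq_big_seq => y yY.
    by rewrite dE//; ring.
  under [in X in _ - X]eq_bigr do rewrite big_split/= -mulr_sumr.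
  by rewrite !big_split/= -!mulr_sumr /net_mass; ring.
have [netE|netE] := ltP 0 (net_mass (fun x => (E x)%:R)); first by exists E.
have net_h' : 0 < net_mass h'.
  have : m * net_mass (fun x => (E x)%:R) <= 0 by rewrite pmulr_rle0.
  lra.
have h'0 x : 0 <= h' x.
  by rewrite /h'; case: ifP => // /andP[Ex xY]; rewrite subr_ge0 mh.
have h'_supp x : h' x != 0 -> h x != 0.
  by rewrite /h'; case: ifP => [/andP[]//|]; rewrite eqxx.
have [|E' [E'h netE']] := IH h' _ h'0 net_h'; last first.
  by exists E'; split => // x /E'h /h'_supp.
rewrite ltnS in hn; apply: leq_trans hn.
apply: (@ltn_count _ _ _ _ z) => //; first by rewrite hz gt_eqF.
by rewrite negbK /h' hz subrr if_same.
Qed.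

End LayerCake.

Section Sparsification.
Context (R : realType) (X : metricType R).
Implicit Types (E : pred X) (Y : seq X) (mu : X -> R).

Definition outer_boundary (m : R) Y E : pred X :=
  fun x => ~~ E x && has (fun y => E y && (mdist x y <= m)) Y.

Definition mass mu Y E : R := \sum_(x <- Y) mu x * (E x)%:R.

Definition folner_sets (m a S : R) mu : Prop :=
  forall Y, uniq Y -> 0 < \sum_(x <- Y) mu x -> exists E,
    (forall x y, E x -> E y -> mdist x y <= S) /\
    mass mu Y (outer_boundary m Y E) < a * mass mu Y E.

(** Summed over the members of a partition of unity whose variation is small against
    [a / N], [net_mass] is positive: the first term adds up to [a] times the mass of [Y],
    and the second to at most [N] times the variation times that mass. So it is positive
    for some member, and by [layer_cake] for a set on which that member does not
    vanish. *)
Lemma property_A_folner (p m a : R) : 1 <= p -> bounded_geometry X ->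
  property_A X p -> 0 < m -> 0 < a ->
  exists S : R, forall mu, (forall x, 0 <= mu x) -> folner_sets m a S mu.
Proof.
move=> p1 hX A m0 a0; have [N [bs bsP]] := ball_enumeration hX m.
pose e := a / (4 * N.+1%:R).
have e0 : 0 < e by rewrite divr_gt0// mulr_gt0// ltr0n.
have [S [I [psi [psi0 bd one var]]]] := property_A_l1 p1 A m0 e0.
exists S => mu mu0 Y uY muY.
(* finitely many members have at least half of the total value at each point of [Y] *)
have [J uJ halfJ] : exists2 J : seq I, uniq J &
    forall x, x \in Y -> 1 / 2 <= \sum_(i <- J) psi i x.
  elim: (Y) => [|x s [J uJ HJ]]; first by exists [::].
  have [_ [F [finF _] <-]] : exists2 y,
      [set \sum_(i \in F) (psi i x)%:E | F in fsets [set: I]]%E y &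
      ((1 / 2)%:E < y)%E.
    by apply: ereal_sup_gt; rewrite [ltRHS]one lte_fin; lra.
  rewrite fsbig_finite// sumEFin lte_fin => /ltW half.
  exists (undup (finmap.enum_fset (fset_set F) ++ J)); first exact: undup_uniq.
  move=> y; rewrite inE => /orP[/eqP ->|/HJ yJ].
    apply: (le_trans half); apply: sum_le_subset; rewrite ?undup_uniq//.
    by move=> i iF; rewrite mem_undup mem_cat iF.
  apply: (le_trans yJ); apply: sum_le_subset; rewrite ?undup_uniq//.
  by move=> i iJ; rewrite mem_undup mem_cat iJ orbT.
pose w x y : R := mu x * (mdist x y <= m)%R%:R.
have [i _ net_i] : exists2 i, i \in J & 0 < net_mass Y mu w a (psi i).
  apply: sum_gt0_ex; rewrite /net_mass sumrB -mulr_sumr.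
  have massJ : 1 / 2 * \sum_(x <- Y) mu x <= \sum_(i <- J) \sum_(x <- Y) mu x * psi i x.
    rewrite exchange_big/= mulr_sumr !big_seq; apply: ler_sum => x xY.
    by rewrite -mulr_sumr mulrC ler_wpM2l// halfJ.
  have varJ : \sum_(i <- J) \sum_(x <- Y) \sum_(y <- Y) w x y * `|psi i x - psi i y|
      <= N%:R * e * \sum_(x <- Y) mu x.
    rewrite exchange_big/= mulr_sumr; apply: ler_sum => x _.
    rewrite exchange_big/= mulrC.
    apply: (@le_trans _ _ (\sum_(y <- Y) mu x * (mdist x y <= m)%R%:R * e)).
      apply: ler_sum => y _; rewrite -mulr_sumr /w; have [xy|xy] := leP (mdist x y) m.
        by rewrite mulr1 ler_wpM2l// var.
      by rewrite mulr0 !mul0r.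
    rewrite -mulr_suml -mulr_sumr -mulrA ler_wpM2l// ler_wpM2r ?(ltW e0)//.
    rewrite -natr_sum ler_nat.
    rewrite (eq_bigr (fun y => if (mdist x y <= m)%R then 1 else 0)%N); last first.
      by move=> y _; case: (_ <= _)%R.
    rewrite -big_mkcond/= sum1_count -size_filter; have [_ bN bE] := bsP x.
    apply: leq_trans bN; apply: uniq_leq_size; first exact: filter_uniq.
    by move=> y; rewrite mem_filter bE => /andP[].
  have Ne : N%:R * e <= a / 4.
    rewrite /e mulrA ler_pdivrMr ?mulr_gt0 ?ltr0n// [leRHS](_ : _ = N.+1%:R * a).
      by rewrite ler_wpM2r ?ler_nat// ltW.
    by field.
  have : N%:R * e * \sum_(x <- Y) mu x <= a / 4 * \sum_(x <- Y) mu x.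
    by rewrite ler_wpM2r// ltW.
  have : a * (1 / 2 * \sum_(x <- Y) mu x) <=
      a * \sum_(i <- J) \sum_(x <- Y) mu x * psi i x by rewrite ler_wpM2l// ltW.
  have : 0 < a * \sum_(x <- Y) mu x by rewrite mulr_gt0.
  lra.
have [E [E_psi netE]] := layer_cake (psi0 i) net_i.
exists E; split; first by move=> x y /E_psi ? /E_psi; exact: bd.
move: netE; rewrite /net_mass subr_gt0; apply: le_lt_trans.
rewrite /mass; apply: ler_sum => x _; rewrite /outer_boundary.
have w0 y z : 0 <= w y z by rewrite /w mulr_ge0// ler0n.
have [/andP[Ex /hasP[y yY /andP[Ey xy]]]|_] := boolP (_ && _); last first.
  by rewrite mulr0; apply: sumr_ge0 => y _; rewrite mulr_ge0.
rewrite (bigD1_seq y)//= (negbTE Ex) Ey sub0r normrN normr1 /w xy !mulr1 lerDl.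
by apply: sumr_ge0 => z _; rewrite !mulr_ge0.
Qed.

(** Collect a set with small boundary, discard its boundary, and repeat with the
    remaining points: each step discards at most [a] times the mass that it collects. *)
Lemma greedy_blocks (m a S : R) mu : 0 <= a -> (forall x, 0 <= mu x) ->
  folner_sets m a S mu -> forall Y, uniq Y ->
  exists (Om : pred X) (lab : X -> nat),
  [/\ forall x, Om x -> x \in Y,
      forall x y, Om x -> Om y -> lab x != lab y -> m <= mdist x y,
      forall x y, Om x -> Om y -> lab x = lab y -> mdist x y <= S &
      \sum_(x <- Y) mu x <= (1 + a) * mass mu Y Om].
Proof.
move=> a0 mu0 folner Y; have [n] := ubnP (size Y).
elim: n Y => // n IH Y sY uY.
have [muY|muY] := ltP 0 (\sum_(x <- Y) mu x); last first.
  exists xpred0, (fun=> 0%N); split => //; apply: (le_trans muY).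
  by rewrite /mass big1 ?mulr0// => x _; rewrite mulr0.
have [E [diamE bdE]] := folner Y uY muY.
pose bd := outer_boundary m Y E.
pose Y' := [seq x <- Y | ~~ E x && ~~ bd x].
have mass_ge0 Q Z : 0 <= mass mu Z Q by apply: sumr_ge0 => x _; rewrite mulr_ge0.
have [z zY Ez] : exists2 z, z \in Y & 0 < mu z * (E z)%:R.
  apply: sum_gt0_ex; rewrite -/(mass mu Y E) lt_neqAle mass_ge0 andbT.
  apply/eqP => E0; move: bdE; rewrite -E0 mulr0 ltNge => /negP; apply.
  exact: mass_ge0.
have {}Ez : E z by move: Ez; case: (E z); rewrite // mulr0 ltxx.
have [|Om [lab [OmY' sep diamOm massOm]]] := IH Y' _ (filter_uniq _ uY).
  rewrite ltnS in sY; apply: leq_trans sY; rewrite size_filter -[ltnRHS]count_predT.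
  by apply: (@ltn_count _ _ _ _ z) => //; rewrite Ez.
have OmP x : Om x -> [/\ x \in Y, ~~ E x & ~~ bd x].
  by move=> /OmY'; rewrite mem_filter => /andP[/andP[]].
have far x y : Om x -> E y -> y \in Y -> m <= mdist x y.
  move=> /OmP[_ Ex]; rewrite /bd /outer_boundary Ex/= => /hasPn + Ey yY.
  by move=> /(_ y yY); rewrite Ey/= -ltNge => /ltW.
exists (fun x => (x \in Y) && E x || Om x), (fun x => if E x then 0%N else (lab x).+1).
split.
- by move=> x /orP[/andP[]//|/OmP[]].
- move=> x y /orP[/andP[xY Ex]|Ox] /orP[/andP[yY Ey]|Oy].
  + by rewrite Ex Ey.
  + by rewrite metric_sym => _; exact: far.
  + by move=> _; exact: far.
  + have [[_ /negbTE -> _] [_ /negbTE -> _]] := (OmP x Ox, OmP y Oy).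
    by rewrite eqSS; exact: sep.
- move=> x y /orP[/andP[xY Ex]|Ox] /orP[/andP[yY Ey]|Oy].
  + by move=> _; exact: diamE.
  + by have [_ /negbTE -> _] := OmP y Oy; rewrite Ex.
  + by have [_ /negbTE -> _] := OmP x Ox; rewrite Ey.
  + have [[_ /negbTE -> _] [_ /negbTE -> _]] := (OmP x Ox, OmP y Oy).
    by move=> [] ; exact: diamOm.
- have -> : \sum_(x <- Y) mu x = mass mu Y E + mass mu Y bd + \sum_(x <- Y') mu x.
    rewrite /mass /Y' big_filter [X in _ + X]big_mkcond/= -!big_split/=.
    apply: eq_bigr => x _; rewrite /bd /outer_boundary.
    by case: (E x) => /=; [|case: (has _ _)]; rewrite ?mulr1 ?mulr0 ?addr0 ?add0r.
  have -> : mass mu Y (fun x => (x \in Y) && E x || Om x) = mass mu Y E + mass mu Y' Om.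
    rewrite /mass /Y' big_filter [X in _ + X]big_mkcond/= -big_split/=.
    apply: eq_big_seq => x xY; rewrite xY/=; have := OmP x.
    case: (Om x) => [/(_ isT)[_ Ex bx]|_].
      by rewrite (negbTE Ex) bx /= mulr0 add0r.
    by rewrite orbF !mulr0 if_same addr0.
  rewrite mulrDl mul1r mulrDr; move: massOm; rewrite mulrDl mul1r.
  rewrite -/bd in bdE; lra.
Qed.

End Sparsification.

Section MeasureSparsification.
Context (R : realType) (X : pmetricType R) (hX : bounded_geometry X).
Local Notation borelX := (g_sigma_algebraType (@open X)).

Lemma measurable_discrete (A : set borelX) : measurable A.
Proof. by apply: sub_sigma_algebra; exact: open_discrete. Qed.

Lemma measure_seq (mu : {finite_measure set borelX -> \bar R}) (s : seq X) :
  uniq s -> mu [set` s] = (\sum_(x <- s) fine (mu [set x]))%:E.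
Proof.
elim: s => [_|x s IH /= /andP[xs us]].
  by rewrite big_nil set_nil measure0.
rewrite big_cons EFinD -IH// fineK; last by apply: fin_num_measure; exact: measurable_discrete.
have -> : [set` x :: s] = [set x] `|` [set` s].
  apply/seteqP; split => y /=; first by rewrite inE => /orP[/eqP|]; [left|right].
  by rewrite inE => -[->|->]; rewrite ?eqxx ?orbT.
rewrite [LHS]measureU//; [exact: measurable_discrete..|].
by apply/seteqP; split => // y [/= -> ys]; rewrite ys in xs.
Qed.

(** The balls about a point are finite and exhaust the space, so a finite subset carries
    almost all of the mass. *)
Lemma finite_set_mass (mu : {finite_measure set borelX -> \bar R}) (c : R) :
  0 < c < 1 -> exists2 Y : seq X, uniq Y &
    c * fine (mu [set: X]) <= \sum_(x <- Y) fine (mu [set x]).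
Proof.
move=> /andP[c0 c1]; have finT : mu [set: X] \is a fin_num.
  by apply: fin_num_measure; exact: measurable_discrete.
have [T0|T0] := leP (fine (mu [set: X])) 0.
  by exists [::] => //; rewrite big_nil pmulr_rle0.
pose F n : set borelX := cball (point : X) n%:R.
have FT : \bigcup_n F n = [set: borelX].
  apply/seteqP; split => // x _; exists (Num.trunc (mdist (point : X) x)).+1 => //.
  by rewrite /F /cball /= ltW// truncnS_gt.
have supF : mu [set: X] = ereal_sup (range (mu \o F)).
  have ndF : nondecreasing_seq F.
    move=> m n mn; apply/subsetPset => x; rewrite /F /cball /= => xm.
    by apply: (le_trans xm); rewrite ler_nat.
  have cv1 := @nondecreasing_cvg_mu _ borelX R mu F
    (fun i => @measurable_discrete (F i)) (@measurable_discrete _) ndF.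
  rewrite FT in cv1.
  have cv2 : mu \o F @ \oo --> ereal_sup (range (mu \o F)).
    apply: ereal_nondecreasing_cvgn => m n mn /=.
    by apply: le_measure; rewrite ?inE; [exact: measurable_discrete..|exact/subsetPset/ndF].
  by rewrite -(cvg_lim _ cv1)// (cvg_lim _ cv2).
have [_ [n _ <-]] : exists2 y, range (mu \o F) y & ((c * fine (mu [set: X]))%:E < y)%E.
  by apply: ereal_sup_gt; rewrite -supF -[ltRHS]fineK// lte_fin gtr_pMl.
have [N [bs /(_ point)[ub _ bE]]] := ball_enumeration hX n%:R.
move=> /= /ltW cn; exists (bs point) => //; rewrite -lee_fin -measure_seq//.
apply: (le_trans cn); rewrite le_eqVlt; apply/orP; left; apply/eqP; congr (mu _).
by apply/seteqP; split => x; rewrite /F /cball /= bE.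
Qed.

Lemma property_A_sparsification (p : R) : 1 <= p ->
  property_A X p -> metric_sparsification X.
Proof.
move=> p1 A c c01.
(* a proportion [c1 = (1 + a)^-1] survives the restriction to a finite set and again
   the greedy choice, and [c1 ^+ 2] exceeds [c] *)
pose c1 := (1 + c) / 2; pose a := (1 - c) / (1 + c).
have [c0 c_lt1] := andP c01.
have a0 : 0 < a by rewrite divr_gt0; lra.
have c101 : 0 < c1 < 1 by rewrite /c1; apply/andP; split; lra.
have ca : c1 * (1 + a) = 1 by rewrite /c1 /a; field; lra.
have cc : c <= c1 * c1 by rewrite /c1; have := sqr_ge0 (1 - c); rewrite expr2; lra.
have scale m : exists S : R, forall mu : X -> R, (forall x, 0 <= mu x) ->
    folner_sets m.+1%:R a S mu.
  by apply: (property_A_folner p1 hX A) => //; rewrite ltr0n.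
pose S m := projT1 (cid (scale m)).
have SP m := projT2 (cid (scale m)).
(* summing makes the function nondecreasing *)
pose f m := (\sum_(k < m.+1) (Num.trunc (S k)).+1)%N.
exists f => [m n mn|m mu].
  rewrite /f -!(big_mkord xpredT (fun k => (Num.trunc (S k)).+1)).
  by rewrite [leqRHS](@big_cat_nat _ _ _ m.+1)//= leq_addr.
have Sf : S m <= (f m)%:R.
  apply: (@le_trans _ _ (Num.trunc (S m)).+1%:R); first by rewrite ltW// truncnS_gt.
  by rewrite ler_nat /f big_ord_recr/= leq_addl.
have [Y uY massY] := finite_set_mass mu c101.
pose w x := fine (mu [set x]); have w0 x : 0 <= w x by rewrite fine_ge0.
have [Om [lab [OmY sep bd massOm]]] := greedy_blocks (ltW a0) w0 (SP m w w0) uY.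
exists nat, (fun i => [set x | Om x /\ lab x = i]); split.
- by move=> i j _ _ [x [[_ <-] [_ <-]]].
- exact: measurable_discrete.
- move=> i j ij; apply: le_ereal_inf_tmp => _ [[x y] [/= [Ox xi] [Oy yj]] <-].
  rewrite lee_fin; apply: (@le_trans _ _ m.+1%:R); first by rewrite ler_nat.
  by apply: sep => //; rewrite xi yj; apply/eqP.
- move=> i; apply: ge_ereal_sup => _ [[x y] [/= [Ox xi] [Oy yi]] <-].
  by rewrite lee_fin; apply: le_trans Sf; apply: bd => //; rewrite xi yi.
- have -> : \bigcup_i [set x | Om x /\ lab x = i] = [set` [seq x <- Y | Om x]].
    apply/seteqP; split => x /=; rewrite mem_filter.
      by move=> [i _ [Ox _]]; rewrite Ox OmY.
    by move=> /andP[Ox _]; exists (lab x).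
  rewrite measure_seq ?filter_uniq// -[mu [set: X]]fineK; last first.
    by apply: fin_num_measure; exact: measurable_discrete.
  rewrite -EFinM lee_fin big_filter big_mkcond/=.
  have massE : mass w Y Om = \sum_(x <- Y) (if Om x then fine (mu [set x]) else 0).
    by apply: eq_bigr => x _; case: (Om x); rewrite ?mulr1 ?mulr0.
  rewrite -massE; move: massY massOm; rewrite -/w; set q := fine _; set Q := \sum_(x <- Y) _.
  have q0 : 0 <= q by rewrite fine_ge0.
  move=> massY massOm; have : c * q <= c1 * c1 * q by rewrite ler_wpM2r.
  have : c1 * (c1 * q) <= c1 * Q by rewrite ler_wpM2l//; case/andP: c101; lra.
  have : c1 * Q <= c1 * ((1 + a) * mass w Y Om).
    by rewrite ler_wpM2l//; case/andP: c101; lra.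
  rewrite [c1 * (_ * mass _ _ _)]mulrA ca mul1r; lra.
Qed.

End MeasureSparsification.

(** * Finite matrices as operators *)

Section KernelOperators.
Context (R : realType) (X : choiceType) (I : finType) (e : I -> X).
Hypothesis e_inj : injective e.
Local Notation C := R[i].
Implicit Types (g : I -> C) (T : I -> I -> R).

Lemma big_preimage g i : \sum_(j | e j == e i) g j = g i.
Proof. by rewrite (big_pred1 i)// => j; apply/eqP/eqP => [/e_inj|->]. Qed.

Lemma sum_codom (F : X -> R) : \sum_(x <- map e (enum I)) F x = \sum_i F (e i).
Proof. by rewrite big_map big_enum. Qed.

Lemma uniq_codom : uniq (map e (enum I)).
Proof. by rewrite map_inj_uniq// enum_uniq. Qed.

Lemma notin_codom x : x \notin map e (enum I) -> forall i, e i == x = false.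
Proof.
move=> xe i; apply: contraNF xe => /eqP <-.
by apply: map_f; rewrite mem_enum.
Qed.

Lemma extend_sqsummable g :
  (fun x => \sum_(i | e i == x) g i) \in @sqsummable R X.
Proof.
apply/sqsummableP; rewrite /sqsum (@esum_seq _ _ _ (map e (enum I))).
- exact: ltry.
- exact: uniq_codom.
- by move=> x; exact: sqr_ge0.
- move=> x /notin_codom xe; rewrite big_pred0 ?normc0 ?expr0n//.
Qed.

Definition extend g : ell2 R X := Ell2 (extend_sqsummable g).

Lemma extendE g i : extend g (e i) = g i.
Proof. exact: big_preimage. Qed.

Lemma sqr_l2norm_extend g : l2norm (extend g) ^+ 2 = \sum_i normc (g i) ^+ 2.
Proof.
rewrite (@sqr_l2norm_seq _ _ _ (map e (enum I)) uniq_codom).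
  by rewrite sum_codom; apply: eq_bigr => i _; rewrite extendE.
by move=> x /notin_codom xe; rewrite /= big_pred0.
Qed.

Definition kernel_row T (v : ell2 R X) i : C := \sum_j (T i j)%:C%C * v (e j).

Definition kernel_fun T v : ell2 R X := extend (kernel_row T v).

Lemma kernel_linear T : linear (kernel_fun T).
Proof.
move=> a u v; apply/val_inj/funext => x.
rewrite -[RHS]/(a * kernel_fun T u x + kernel_fun T v x) /= mulr_sumr -big_split/=.
apply: eq_bigr => i _; rewrite /kernel_row mulr_sumr -big_split/=.
apply: eq_bigr => j _; rewrite -[(_ *: _ + _) _]/(a * u (e j) + v (e j)).
by rewrite mulrDr mulrCA.
Qed.

HB.instance Definition _ T :=
  GRing.isLinear.Build C (ell2 R X) (ell2 R X) *:%R (kernel_fun T) (kernel_linear T).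

Lemma normc_kernel_row T v i :
  normc (kernel_row T v i) <= \sum_j `|T i j| * normc (v (e j)).
Proof.
rewrite /kernel_row; elim/big_ind2: _ => [|a a' b b' aa bb|j _].
- by rewrite normc0.
- by apply: le_trans (le_normcD _ _) _; exact: lerD.
- by rewrite normc_realM.
Qed.

Lemma kernel_bounded T : exists K, forall v, l2norm (kernel_fun T v) <= K * l2norm v.
Proof.
exists (Num.sqrt (\sum_i (\sum_j `|T i j|) ^+ 2)) => v.
have K0 : 0 <= \sum_i (\sum_j `|T i j|) ^+ 2.
  by apply: sumr_ge0 => i _; exact: sqr_ge0.
rewrite -ler_sqr ?nnegrE ?mulr_ge0 ?sqrtr_ge0 ?l2norm_ge0// exprMn (sqr_sqrtr K0).
rewrite /kernel_fun sqr_l2norm_extend mulr_suml; apply: ler_sum => i _; rewrite -exprMn.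
rewrite ler_sqr ?nnegrE ?normc_ge0 ?mulr_ge0 ?l2norm_ge0 ?sumr_ge0//.
apply: le_trans (normc_kernel_row T v i) _; rewrite mulr_suml.
by apply: ler_sum => j _; rewrite ler_wpM2l// normc_le_l2norm.
Qed.

Definition kernel_op T : bounded_op R X := BoundedOp (kernel_bounded T).

Lemma sqr_l2norm_kernel T v :
  l2norm (kernel_op T v) ^+ 2 = \sum_i normc (kernel_row T v i) ^+ 2.
Proof. exact: sqr_l2norm_extend. Qed.

Lemma kernel_scale (t : R) T v : l2norm (kernel_op (fun i j => t * T i j) v) =
  `|t| * l2norm (kernel_op T v).
Proof.
apply/eqP; rewrite -(@eqrXn2 _ 2)// ?mulr_ge0 ?l2norm_ge0// exprMn.
rewrite !sqr_l2norm_kernel mulr_sumr; apply/eqP; apply: eq_bigr => i _.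
rewrite -exprMn -normc_realM /kernel_row mulr_sumr; congr (normc _ ^+ 2).
by apply: eq_bigr => j _; rewrite rmorphM mulrA.
Qed.

Lemma opnorm_kernel_normalise T : opnorm (kernel_op T) != 0 ->
  opnorm (kernel_op (fun i j => (opnorm (kernel_op T))^-1 * T i j)) = 1.
Proof.
move=> n0; set n := opnorm _ in n0 *.
have np : 0 < n by rewrite lt_neqAle eq_sym n0 opnorm_ge0.
apply/eqP; rewrite eq_le; apply/andP; split.
  apply: opnorm_le => // s v _ _; rewrite kernel_scale ger0_norm ?invr_ge0 ?(ltW np)//.
  by rewrite mul1r ler_pdivrMl// ler_opnorm.
rewrite -(ler_pM2l np) mulr1; apply: opnorm_le => [|s v _ _].
  by rewrite mulr_ge0 ?opnorm_ge0// ltW.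
rewrite -mulrA -ler_pdivrMl//.
by have := ler_opnorm (kernel_op (fun i j => n^-1 * T i j)) v;
  rewrite kernel_scale ger0_norm ?invr_ge0 ?(ltW np).
Qed.

End KernelOperators.

(** * Localisation bounds quadratic forms *)

Section LocalForms.
Context (R : realType) (X : metricType R).

Definition localises (c r s : R) : Prop :=
  forall a : bounded_op R X, propagation_le r a -> opnorm a = 1 ->
    exists v : ell2 R X, [/\ l2norm v = 1, (diam (supp v) <= s%:E)%E & c <= l2norm (a v)].

Section FiniteSubset.
Context (I : finType) (e : I -> X) (e_inj : injective e).
Implicit Types (z u : I -> R) (T : I -> I -> R).

Definition local (S : R) z : Prop :=
  forall i j, z i != 0 -> z j != 0 -> mdist (e i) (e j) <= S.

Definition form T z u : R := \sum_i \sum_j T i j * z i * u j.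

Lemma propagation_kernel (r : R) T :
  (forall i j, T i j != 0 -> mdist (e i) (e j) <= r) ->
  propagation_le r (kernel_op e_inj T).
Proof.
move=> Tr f f' ff' v; apply/val_inj/funext => x.
rewrite -[LHS]/(f x * (\sum_(i | e i == x) \sum_j (T i j)%:C%C * (f' (e j) * v (e j)))).
rewrite -[RHS]/0 mulr_sumr big1// => i /eqP <-; rewrite mulr_sumr big1// => j _.
have [->|Tij] := eqVneq (T i j) 0; first by rewrite mul0r mulr0.
have [->|fi] := eqVneq (f (e i)) 0; first by rewrite mul0r.
have [->|fj] := eqVneq (f' (e j)) 0; first by rewrite mul0r !mulr0.
have : (set_dist (supp f) (supp f') <= (mdist (e i) (e j))%:E)%E.
  by apply: ereal_inf_lbound; exists (e i, e j).
by move=> /(lt_le_trans ff'); rewrite lte_fin ltNge Tr.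
Qed.

(** For [w = |v|] and [g = T w], and [q] the quadratic form of [T], polarisation gives
    [4 * |g|^2 = q (w + g) - q (w - g) <= 2 * |w|^2 + 2 * |g|^2], whence [|g| <= |w|].
    Here [- q (w - g)] is bounded by the value of [q] at the absolute value of [w - g],
    because the entries of [T] are nonnegative. *)
Lemma kernel_contracts_local (r s : R) T (v : ell2 R X) : 0 <= r ->
  (forall i j, 0 <= T i j) -> (forall i j, T i j = T j i) ->
  (forall i j, T i j != 0 -> mdist (e i) (e j) <= r) ->
  (forall z, local (s + 2 * r) z -> form T z z <= \sum_i z i ^+ 2) ->
  (diam (supp v) <= s%:E)%E -> l2norm (kernel_op e_inj T v) <= l2norm v.
Proof.
move=> r0 T0 Tsym Tr Tloc vs.
pose w i := normc (v (e i)); pose g i := \sum_j T i j * w j.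
have w0 i : 0 <= w i by exact: normc_ge0.
have g0 i : 0 <= g i by apply: sumr_ge0 => j _; rewrite mulr_ge0.
have near i : w i != 0 \/ g i != 0 -> exists2 j, w j != 0 & mdist (e i) (e j) <= r.
  move=> [wi|]; first by exists i; rewrite // mdistxx.
  rewrite psumr_neq0 => [|j _]; last by rewrite mulr_ge0.
  move=> /hasP[j _ /=]; rewrite lt_neqAle eq_sym mulf_eq0 negb_or => /andP[/andP[Tij wj] _].
  by exists j => //; exact: Tr.
have loc z : (forall i, z i != 0 -> w i != 0 \/ g i != 0) -> local (s + 2 * r) z.
  move=> zP i j /zP/near[i' wi ii] /zP/near[j' wj jj].
  have ij' : mdist (e i') (e j') <= s.
    rewrite -lee_fin; apply: le_trans vs; apply: ereal_sup_ubound.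
    exists (e i', e j') => //; split; rewrite /supp /=.
      by apply: contra wi => /eqP vi; rewrite /w vi normc0.
    by apply: contra wj => /eqP vj; rewrite /w vj normc0.
  apply: le_trans (metric_triangle _ (e i') _) _.
  have := metric_triangle (e i') (e j') (e j); rewrite [mdist (e j') _]metric_sym; lra.
have plus := Tloc (fun i => w i + g i) _.
have minus := Tloc (fun i => `|w i - g i|) _.
have {}plus : form T (fun i => w i + g i) (fun i => w i + g i) <=
    \sum_i (w i + g i) ^+ 2.
  apply: plus; apply: loc => i; have [->|] := eqVneq (w i) 0; last by left.
  by rewrite add0r; right.
have {}minus : form T (fun i => `|w i - g i|) (fun i => `|w i - g i|) <=
    \sum_i `|w i - g i| ^+ 2.
  apply: minus; apply: loc => i; have [->|] := eqVneq (w i) 0; last by left.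
  by rewrite sub0r normr_eq0 oppr_eq0; right.
have neg : - form T (fun i => `|w i - g i|) (fun i => `|w i - g i|) <=
    form T (fun i => w i - g i) (fun i => w i - g i).
  rewrite -sumrN; apply: ler_sum => i _; rewrite -sumrN; apply: ler_sum => j _.
  rewrite -!mulrA -mulrN ler_wpM2l// -normrM lerNl -normrN.
  exact: ler_norm.
have wg : form T g w = \sum_i g i ^+ 2.
  apply: eq_bigr => i _; rewrite expr2 [X in _ = X * _]/g mulr_suml.
  by apply: eq_bigr => j _; ring.
have gw : form T w g = \sum_i g i ^+ 2.
  rewrite -wg /form exchange_big/=; apply: eq_bigr => i _; apply: eq_bigr => j _.
  by rewrite Tsym; ring.
have polar : form T (fun i => w i + g i) (fun i => w i + g i) -
    form T (fun i => w i - g i) (fun i => w i - g i) = 4 * \sum_i g i ^+ 2.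
  have -> : 4 * \sum_i g i ^+ 2 = 2 * form T g w + 2 * form T w g by rewrite wg gw; ring.
  rewrite /form -sumrB !mulr_sumr -big_split/=; apply: eq_bigr => i _.
  rewrite -sumrB !mulr_sumr -big_split/=; apply: eq_bigr => j _; ring.
have squares : \sum_i (w i + g i) ^+ 2 + \sum_i `|w i - g i| ^+ 2 =
    2 * \sum_i w i ^+ 2 + 2 * \sum_i g i ^+ 2.
  rewrite !mulr_sumr -!big_split/=; apply: eq_bigr => i _.
  by rewrite real_normK ?num_real//; ring.
have gle : \sum_i g i ^+ 2 <= \sum_i w i ^+ 2 by lra.
rewrite -ler_sqr ?nnegrE ?l2norm_ge0//.
have wv : \sum_i w i ^+ 2 <= l2norm v ^+ 2.
  by have := sum_le_l2norm v (uniq_codom e_inj); rewrite sum_codom.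
apply: le_trans wv; apply: le_trans gle; rewrite sqr_l2norm_kernel.
apply: ler_sum => i _; rewrite ler_sqr ?nnegrE ?normc_ge0//.
apply: le_trans (normc_kernel_row e T v i) _; apply: ler_sum => j _.
by rewrite ger0_norm.
Qed.

Lemma form_le_opnorm T u :
  form T u u <= opnorm (kernel_op e_inj T) * \sum_i u i ^+ 2.
Proof.
set n := opnorm _; have n0 : 0 <= n by exact: opnorm_ge0.
pose U := \sum_i u i ^+ 2; have U0 : 0 <= U by apply: sumr_ge0 => i _; exact: sqr_ge0.
pose v : ell2 R X := extend e_inj (fun i => (u i)%:C%C).
pose G i := \sum_j T i j * u j.
have vU : l2norm v ^+ 2 = U.
  rewrite sqr_l2norm_extend; apply: eq_bigr => i _.
  by rewrite normc_real real_normK ?num_real.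
have GU : \sum_i G i ^+ 2 <= n ^+ 2 * U.
  have -> : \sum_i G i ^+ 2 = l2norm (kernel_op e_inj T v) ^+ 2.
    rewrite sqr_l2norm_kernel; apply: eq_bigr => i _.
    have -> : kernel_row e T v i = (G i)%:C%C.
      by rewrite /G rmorph_sum; apply: eq_bigr => j _; rewrite rmorphM extendE.
    by rewrite normc_real real_normK ?num_real.
  rewrite -vU -exprMn ler_sqr ?nnegrE ?mulr_ge0 ?l2norm_ge0//.
  exact: ler_opnorm.
have formE : form T u u = \sum_i G i * u i.
  apply: eq_bigr => i _; rewrite mulr_suml; apply: eq_bigr => j _; ring.
have main t : n < t -> form T u u <= t * U.
  move=> nt; have t0 : 0 < t by exact: le_lt_trans nt.
  have : 2 * t * form T u u <= \sum_i G i ^+ 2 + t ^+ 2 * U.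
    rewrite formE !mulr_sumr -big_split/=; apply: ler_sum => i _.
    have := sqr_ge0 (G i - t * u i); rewrite -subr_ge0; congr (is_true (_ <= _)); ring.
  have : n ^+ 2 * U <= t ^+ 2 * U.
    by rewrite ler_wpM2r// ler_sqr ?nnegrE// ltW.
  move=> h1 h2; rewrite -(ler_pM2l t0) (mulrA t t) -(expr2 t); move: GU h1 h2.
  by move: (form T u u) (\sum_i G i ^+ 2) => F Q; lra.
apply/ler_addgt0Pr => d d0.
have U1 : 0 < U + 1 by lra.
have := main (n + d / (U + 1)); rewrite ltrDl divr_gt0// => /(_ isT) H.
apply: (le_trans H); rewrite mulrDl lerD2l mulrAC ler_pdivrMr// ler_pM2l//.
by rewrite /U; lra.
Qed.

(** A bound on the quadratic form on local vectors gives, up to the factor [c], the same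
    bound on all vectors: localisation transfers the bound on norms of
    [kernel_contracts_local] from local vectors to the operator norm. *)
Lemma localises_form (c r s : R) T u : localises c r s -> 0 < c -> 0 <= r ->
  (forall i j, 0 <= T i j) -> (forall i j, T i j = T j i) ->
  (forall i j, T i j != 0 -> mdist (e i) (e j) <= r) ->
  (forall z, local (s + 2 * r) z -> form T z z <= \sum_i z i ^+ 2) ->
  c * form T u u <= \sum_i u i ^+ 2.
Proof.
move=> onl c0 r0 T0 Tsym Tr Tloc; set n := opnorm (kernel_op e_inj T).
have U0 : 0 <= \sum_i u i ^+ 2 by apply: sumr_ge0 => i _; exact: sqr_ge0.
suff cn : c * n <= 1.
  apply: (@le_trans _ _ (c * n * \sum_i u i ^+ 2)); last by rewrite ler_piMl.
  by rewrite -mulrA ler_pM2l// form_le_opnorm.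
have [n0|n0] := eqVneq n 0; first by rewrite n0 mulr0 ler01.
have np : 0 < n by rewrite lt_neqAle eq_sym n0 opnorm_ge0.
have [|v [v1 vs cv]] := onl _ _ (opnorm_kernel_normalise n0).
  apply: propagation_kernel => i j; rewrite mulf_eq0 negb_or => /andP[_].
  exact: Tr.
move: cv; rewrite kernel_scale ger0_norm ?invr_ge0 ?(ltW np)// ler_pdivlMl//.
rewrite mulrC => cv; apply: (le_trans cv); rewrite -v1.
exact: kernel_contracts_local Tloc vs.
Qed.

End FiniteSubset.
End LocalForms.

(** * Gram matrices of local vectors *)

Section GramFamilies.
Context (R : realType) (X : metricType R) (I : finType) (e : I -> X).
Hypothesis e_inj : injective e.
Variables (c c' r s : R).
Hypotheses (onl : localises X c r s) (c0 : 0 < c) (c'c : c' < c)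
  (c'1 : c' <= 1) (r0 : 0 <= r) (s0 : 0 <= s).

Let S : R := s + 2 * r.
Let close i j : bool := mdist (e i) (e j) <= r.

Let S0 : 0 <= S. Proof. by rewrite addr_ge0// mulr_ge0. Qed.
Let rS : r <= S. Proof. by rewrite /S mulr_natl mulr2n addrA lerDr addr_ge0. Qed.

Lemma closeC i j : close i j = close j i. Proof. by rewrite /close metric_sym. Qed.
Lemma closexx i : close i i. Proof. by rewrite /close mdistxx. Qed.

(** The convex cone of the Gram matrices of families of local vectors, cut off at
    distance [r]; subtracting [q] makes a separating functional nonpositive off the
    diagonal. *)
Let K : set (I * I -> R) := [set k | exists (J : finType) (V : J -> I -> R) (q : I * I -> R),
  [/\ forall j, local e S (V j), forall ij, 0 <= q ij, forall i, q (i, i) = 0 &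
      forall i j, k (i, j) = (close i j)%:R * (\sum_a V a i * V a j) - q (i, j)]].

Let tau (ij : I * I) : R := (close ij.1 ij.2)%:R * (if ij.1 == ij.2 then 1 else c').

(** A functional [ell] that is nonnegative on [K] and negative at [tau] is, on symmetric
    matrices, the difference of a nonnegative diagonal [lam] and a symmetric matrix [A]
    with nonnegative entries. Nonnegativity on [K] says that the form of [A] is at most
    that of [lam] on local vectors; negativity at [tau] says that the sum of the [lam i]
    is less than [c'] times the sum of the entries of [A]. *)
Section Separated.
Variable ell : I * I -> R.
Hypotheses (ellK : forall k, K k -> 0 <= \sum_ij ell ij * k ij)
  (ell_tau : \sum_ij ell ij * tau ij < 0).

Let lam i := ell (i, i).
Let A i j := if (i != j) && close i j then - (ell (i, j) + ell (j, i)) / 2 else 0.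

Lemma symmetric_part (M : I -> I -> R) : (forall i j, M i j = M j i) ->
  \sum_ij ell ij * ((close ij.1 ij.2)%:R * M ij.1 ij.2) =
  \sum_i lam i * M i i - \sum_i \sum_j A i j * M i j.
Proof.
move=> Msym; pose F i j := ell (i, j) * ((close i j)%:R * M i j).
have -> : \sum_ij ell ij * ((close ij.1 ij.2)%:R * M ij.1 ij.2) =
    \sum_i \sum_j F i j.
  by rewrite pair_bigA/=; apply: eq_bigr => -[i j].
have FE : \sum_i \sum_j F i j = \sum_i \sum_j (F i j + F j i) / 2.
  under [RHS]eq_bigr do rewrite -mulr_suml big_split/=.
  by rewrite -mulr_suml big_split/= [X in _ + X]exchange_big/= mulrDl -splitr.
rewrite FE -sumrB; apply: eq_bigr => i _.
rewrite (bigD1 i)//= [X in _ - X](bigD1 i)//= /A eqxx/= mul0r add0r.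
rewrite /F closexx /lam -sumrN; congr (_ + _).
  by rewrite mul1r mulrDl -splitr.
apply: eq_bigr => j ij; rewrite eq_sym ij/= (closeC j i) (Msym j i).
by case: (close i j); rewrite ?mul1r ?mul0r /=; field.
Qed.

Lemma local_ge0 (z : I -> R) : local e S z ->
  \sum_i \sum_j A i j * (z i * z j) <= \sum_i lam i * z i ^+ 2.
Proof.
move=> zS; rewrite -subr_ge0; under [X in X - _]eq_bigr do rewrite expr2.
rewrite -(@symmetric_part (fun i j => z i * z j)) => [|i j]; last exact: mulrC.
apply: ellK; exists unit, (fun _ => z), (fun=> 0); split => // i j.
by rewrite subr0 (big_pred1 tt)//; case.
Qed.

Lemma A_ge0 i j : 0 <= A i j.
Proof.
rewrite /A; case: ifP => // /andP[ij _].
have neg a b : a != b -> ell (a, b) <= 0.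
  move=> ab; have /ellK : K (fun ij => - (ij == (a, b))%:R).
    exists void, (fun _ _ => 0), (fun ij => (ij == (a, b))%:R); split => //.
    - move=> x; rewrite xpair_eqE; case: (x =P a) => //= ->.
      by rewrite (negbTE ab).
    - by move=> x y; rewrite big_pred0 ?mulr0 ?sub0r//; case.
  rewrite (bigD1 (a, b))//= eqxx mulrN1 big1 ?addr0 ?oppr_ge0// => ij' /negbTE ->.
  by rewrite oppr0 mulr0.
by have := neg _ _ ij; rewrite eq_sym in ij; have := neg _ _ ij; lra.
Qed.

Lemma A_sym i j : A i j = A j i.
Proof. by rewrite /A eq_sym closeC addrC. Qed.

Lemma A_near i j : A i j != 0 -> mdist (e i) (e j) <= r.
Proof. by rewrite /A; case: ifP => [/andP[]//|]; rewrite eqxx. Qed.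

Lemma lam_ge0 i : 0 <= lam i.
Proof.
have /local_ge0 : local e S (fun k => (k == i)%:R).
  move=> a b; rewrite !pnatr_eq0 !eqb0 !negbK => /eqP -> /eqP ->.
  by rewrite mdistxx.
rewrite [leRHS](bigD1 i)//= eqxx expr1n mulr1 [X in _ <= _ + X]big1 ?addr0; last first.
  by move=> k /negbTE ->; rewrite expr0n mulr0.
apply: le_trans; apply: sumr_ge0 => a _; apply: sumr_ge0 => b _.
by rewrite !mulr_ge0 ?A_ge0 ?ler0n.
Qed.

(** Otherwise the form of [lam] less that of [A] would be negative at a vector with value
    [1] at [j] and a large value at [i]. *)
Lemma lam_eq0 i j : lam i = 0 -> A i j = 0.
Proof.
move=> li; apply/eqP; rewrite eq_le A_ge0 andbT leNgt; apply/negP => Aij.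
have ij : i != j by apply: contraTneq Aij => ->; rewrite /A eqxx/= ltxx.
pose t := (lam j + 1) / A i j.
have tA : A i j * t = lam j + 1 by rewrite /t mulrC mulfVK// gt_eqF.
have t0 : 0 <= t by rewrite divr_ge0 ?(ltW Aij)//; have := lam_ge0 j; lra.
pose z k : R := if k == i then t else if k == j then 1 else 0.
have z0 k : 0 <= z k by rewrite /z; case: ifP => // _; case: ifP.
have zij k : z k != 0 -> k = i \/ k = j.
  rewrite /z; have [->|_] := eqVneq k i; first by left.
  by have [->|_] := eqVneq k j; [right|rewrite eqxx].
have ijr : mdist (e i) (e j) <= r by apply: A_near; rewrite gt_eqF.
have /local_ge0 : local e S z.
  move=> a b /zij aP /zij bP; apply: (@le_trans _ _ r); last exact: rS.
  by case: aP => ->; case: bP => ->; rewrite ?mdistxx// metric_sym.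
have ji : j != i by rewrite eq_sym.
rewrite [leRHS](bigD1 i)//= li mul0r add0r [leRHS](bigD1 j)//=.
rewrite [X in _ <= _ + X]big1 ?addr0; last first.
  by move=> k /andP[/negbTE ki /negbTE kj]; rewrite /z ki kj expr0n mulr0.
have -> : z j = 1 by rewrite /z eqxx eq_sym (negbTE ij).
rewrite expr1n mulr1 => bound.
have : A i j * (z i * z j) <= \sum_i \sum_j A i j * (z i * z j).
  rewrite (bigD1 i)//= (bigD1 j)//= -addrA lerDl addr_ge0// sumr_ge0// => a _.
    by rewrite !mulr_ge0 ?A_ge0.
  by apply: sumr_ge0 => b _; rewrite !mulr_ge0 ?A_ge0.
have -> : z j = 1 by rewrite /z eqxx eq_sym (negbTE ij).
have -> : z i = t by rewrite /z eqxx.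
rewrite mulr1 tA; lra.
Qed.

(** Let [T] be [A] rescaled by the square roots [u] of [lam]. Its form is at most the
    identity on local vectors, hence at most [c^-1] times the identity on all vectors. But
    the form of [T] at [u] is the sum of the entries of [A], and this exceeds [c^-1] times
    the sum of the [lam i]. *)
Lemma separated_false : False.
Proof.
pose u i := Num.sqrt (lam i).
have uu i : u i ^+ 2 = lam i by rewrite sqr_sqrtr ?lam_ge0.
pose T i j := A i j / (u i * u j).
have Tu i j : T i j * u i * u j = A i j.
  rewrite /T -mulrA; have [ui|ui] := eqVneq (u i) 0.
    by rewrite ui mul0r mulr0 lam_eq0// -uu ui expr0n.
  have [uj|uj] := eqVneq (u j) 0.
    by rewrite uj !mulr0 A_sym lam_eq0// -uu uj expr0n.
  by rewrite mulfVK// mulf_neq0.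
have Tz z : local e S z -> form T z z <= \sum_i z i ^+ 2.
  move=> zS; have /local_ge0 : local e S (fun i => z i / u i).
    move=> i j zi zj; apply: zS.
      by apply: contra zi => /eqP ->; rewrite mul0r.
    by apply: contra zj => /eqP ->; rewrite mul0r.
  have -> : form T z z = \sum_i \sum_j A i j * (z i / u i * (z j / u j)).
    apply: eq_bigr => i _; apply: eq_bigr => j _.
    by rewrite /T invfM; ring.
  move=> /le_trans; apply; apply: ler_sum => i _; rewrite -uu -exprMn.
  have [ui|ui] := eqVneq (u i) 0; first by rewrite ui mul0r expr0n sqr_ge0.
  by rewrite mulrC mulfVK.
have cA : c * (\sum_i \sum_j A i j) <= \sum_i lam i.
  have -> : \sum_i \sum_j A i j = form T u u.
    by apply: eq_bigr => i _; apply: eq_bigr => j _; rewrite Tu.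
  rewrite [leRHS](eq_bigr (fun i => u i ^+ 2)) => [|i _]; last by rewrite uu.
  apply: (@localises_form _ _ _ e e_inj c r s T u onl c0 r0) => // [i j|i j|i j].
  - by rewrite divr_ge0 ?A_ge0// mulr_ge0// sqrtr_ge0.
  - by rewrite /T A_sym [u i * _]mulrC.
  - by rewrite mulf_eq0 negb_or => /andP[/A_near].
have Asum : 0 <= \sum_i \sum_j A i j.
  by apply: sumr_ge0 => i _; apply: sumr_ge0 => j _; exact: A_ge0.
move: ell_tau; rewrite (@symmetric_part (fun i j => if i == j then 1 else c')); last first.
  by move=> i j; rewrite eq_sym.
have -> : \sum_i lam i * (if i == i then 1 else c') = \sum_i lam i.
  by apply: eq_bigr => i _; rewrite eqxx mulr1.
have -> : \sum_i \sum_j A i j * (if i == j then 1 else c') = c' * \sum_i \sum_j A i j.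
  rewrite mulr_sumr; apply: eq_bigr => i _; rewrite mulr_sumr; apply: eq_bigr => j _.
  by case: (eqVneq i j) => [->|_]; rewrite mulrC// /A eqxx/= !mulr0.
have : c' * (\sum_i \sum_j A i j) <= c * \sum_i \sum_j A i j.
  by rewrite ler_wpM2r// ltW.
lra.
Qed.

End Separated.

(** By [separated_false], [tau] is in the closure of [K]. Off the diagonal the Gram matrix
    only exceeds the approximating element of [K], by [q]. *)
Lemma gram_family (eta : R) : 0 < eta ->
  exists (J : finType) (V : J -> I -> R),
  [/\ forall j, local e S (V j),
      forall i, `|\sum_j V j i ^+ 2 - 1| < eta &
      forall i i', mdist (e i) (e i') <= r -> c' - eta < \sum_j V j i * V j i'].
Proof.
move=> eta0; have [| | |approx|[ell [ellK ell_tau]]] := @cone_separation R _ K tau.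
- exists void, (fun _ _ => 0), (fun=> 0); split => // i j.
  by rewrite big_pred0 ?mulr0 ?subr0//; case.
- move=> k k' [J [V [q [VS q0 qd kE]]]] [J' [V' [q' [VS' q0' qd' kE']]]].
  exists (J + J')%type, (fun a => match a with inl j => V j | inr j => V' j end),
    (fun ij => q ij + q' ij); split.
  + by case.
  + by move=> ij; rewrite addr_ge0.
  + by move=> i; rewrite qd qd' addr0.
  + by move=> i j; rewrite kE kE' big_sumType/=; ring.
- move=> t k t0 [J [V [q [VS q0 qd kE]]]].
  exists J, (fun a i => Num.sqrt t * V a i), (fun ij => t * q ij); split.
  + move=> a i j; rewrite !mulf_eq0 !negb_or => /andP[_ Vi] /andP[_ Vj].
    exact: (VS a).
  + by move=> ij; rewrite mulr_ge0.
  + by move=> i; rewrite qd mulr0.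
  + move=> i j; rewrite kE mulrBr; congr (_ - _); rewrite mulrCA; congr (_ * _).
    rewrite mulr_sumr; apply: eq_bigr => a _.
    by rewrite -[in LHS](sqr_sqrtr t0); ring.
- have [k [J [V [q [VS q0 qd kE]]]] kt] := approx eta eta0.
  have diag i : `|\sum_j V j i ^+ 2 - 1| < eta.
    have := kt (i, i); rewrite /tau /= eqxx closexx !mul1r kE qd subr0 closexx mul1r.
    by rewrite (eq_bigr (fun a => V a i ^+ 2)) => // a _; rewrite expr2.
  exists J, V; split => // i i' ii'; have [<-|neq] := eqVneq i i'.
    rewrite (eq_bigr (fun a => V a i ^+ 2)) => [|a _]; last by rewrite expr2.
    have := diag i; rewrite ltr_norml => /andP[lo _].
    by apply: le_lt_trans (_ : 1 - eta < _); [rewrite lerD2r|lra].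
  have := kt (i, i'); rewrite /tau /= (negbTE neq) kE /close ii' !mul1r ltr_norml.
  by have := q0 (i, i'); lra.
- by case: (separated_false ellK ell_tau).
Qed.

End GramFamilies.

(** * From localisation to Property A *)

Section UnitCube.
Context (R : realType) (X : eqType) (J : eqType).

(** The net [f], indexed by the finite subsets of [X], has a cluster point in the
    cube, which is compact by Tychonoff's theorem. *)
Lemma unit_cube_cluster (f : seq X -> J -> R) : (forall F j, 0 <= f F j <= 1) ->
  exists g : J -> R, forall (s : seq J) (F0 : seq X) (eta : R), 0 < eta ->
    exists F, [/\ uniq F, {subset F0 <= F} & \sum_(j <- s) `|f F j - g j| < eta].
Proof.
move=> f01; pose cube := prod_topology (fun _ : J => (R : topologicalType)).
pose above (F0 : seq X) := [set F | uniq F /\ {subset F0 <= F}].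
have above_proper : ProperFilter (filter_from setT above).
  apply: filter_from_proper => [|F0 _]; last first.
    exists (undup F0); split; first exact: undup_uniq.
    by move=> x; rewrite mem_undup.
  apply: filter_from_filter => [|F0 F1 _ _]; first by exists [::].
  exists (F0 ++ F1) => // F [uF sF]; split; split => // x xF; apply: sF.
    by rewrite mem_cat xF.
  by rewrite mem_cat xF orbT.
have cube_compact := @tychonoff J (fun=> R : topologicalType)
  (fun=> [set` `[0, 1]]) (fun=> segment_compact (a := 0) (b := 1)).
have [|g [_ g_cluster]] := cube_compact ((f : seq X -> cube) @ filter_from setT above) _.
  by exists [::] => // F _ j /=; rewrite in_itv/= f01.
exists g => s F0 eta eta0.
pose dev (h : cube) : R := \sum_(j <- s) `|h j - g j|.
have dev_cont : continuous dev.
  apply: continuous_big => [[u v]|j _]; first exact: add_continuous.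
  move=> h; apply: (@continuous_comp _ _ _ (fun h : cube => h j - g j) Num.norm).
    apply: (@cvgB _ _ _ (nbhs h)); last exact: cvg_cst.
    exact: (@proj_continuous J (fun=> R : topologicalType) j h).
  exact: norm_continuous.
have dev0 : nbhs (g : cube) [set h | dev h < eta].
  have : nbhs (dev g) [set y | y < eta].
    by apply: open_nbhs_nbhs; split; [exact: open_lt|rewrite /= /dev big1// => j _;
      rewrite subrr normr0].
  exact: dev_cont.
have [|_ [[F [uF sF] <-] Fdev]] := g_cluster [set h | exists2 F, above F0 F & f F = h] _ _ dev0.
  by exists F0 => // F FF0; exists F.
by exists F.
Qed.

End UnitCube.

(** Unit vectors with inner product near [1] are close, and then so are their squares in
    the l1 norm: [|u^2 - v^2|] is the product of [|u - v|] and [|u + v|], and a weighted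
    arithmetic-geometric mean inequality splits it. *)
Lemma sqr_variation_l1 (R : realType) (J : Type) (r : seq J) (u v : J -> R) (e : R) :
  0 < e -> \sum_(j <- r) u j ^+ 2 = 1 -> \sum_(j <- r) v j ^+ 2 = 1 ->
  1 - e ^+ 2 / 8 <= \sum_(j <- r) u j * v j ->
  \sum_(j <- r) `|u j ^+ 2 - v j ^+ 2| <= e.
Proof.
move=> e0 u1 v1; set k := \sum_(j <- r) _ => k1.
have pt j : e * `|u j ^+ 2 - v j ^+ 2| <=
    2 * (u j - v j) ^+ 2 + e ^+ 2 / 8 * (u j + v j) ^+ 2.
  have -> : u j ^+ 2 - v j ^+ 2 = (u j - v j) * (u j + v j) by ring.
  rewrite normrM -[(u j - v j) ^+ 2]real_normK ?num_real//.
  rewrite -[(u j + v j) ^+ 2]real_normK ?num_real//.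
  move: `|u j - v j| `|u j + v j| => p q.
  rewrite -subr_ge0 (_ : _ - _ = 2 * (p - e / 4 * q) ^+ 2); last by field.
  by rewrite mulr_ge0// sqr_ge0.
have minus : \sum_(j <- r) (u j - v j) ^+ 2 = 2 - 2 * k.
  transitivity (\sum_(j <- r) u j ^+ 2 + \sum_(j <- r) v j ^+ 2 - 2 * k); last first.
    by rewrite u1 v1; ring.
  rewrite mulr_sumr -big_split/= -sumrB.
  by apply: eq_bigr => j _; ring.
have plus : \sum_(j <- r) (u j + v j) ^+ 2 = 2 + 2 * k.
  transitivity (\sum_(j <- r) u j ^+ 2 + \sum_(j <- r) v j ^+ 2 + 2 * k); last first.
    by rewrite u1 v1; ring.
  rewrite mulr_sumr -!big_split/=.
  by apply: eq_bigr => j _; ring.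
have minus0 : 0 <= 2 - 2 * k by rewrite -minus; apply: sumr_ge0 => j _; exact: sqr_ge0.
have total : e * \sum_(j <- r) `|u j ^+ 2 - v j ^+ 2| <=
    2 * (2 - 2 * k) + e ^+ 2 / 8 * (2 + 2 * k).
  by rewrite -minus -plus !mulr_sumr -big_split/=; apply: ler_sum => j _; exact: pt.
rewrite -(ler_pM2l e0) -(expr2 e); apply: (le_trans total).
have : e ^+ 2 / 8 * (2 + 2 * k) <= e ^+ 2 / 8 * 4.
  by rewrite ler_wpM2l//; [rewrite divr_ge0// sqr_ge0|lra].
lra.
Qed.

Section LocalisationToPropertyA.
Context (R : realType) (X : metricType R).

(** An l1 partition of unity on [F] indexed by the points of [F], where [q (z, x)] is the
    value at [x] of the member with index [z]. *)
Definition partition_on (r e S : R) (F : seq X) (q : X * X -> R) : Prop :=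
  [/\ forall zx, 0 <= q zx <= 1,
      forall z x, S < mdist z x -> q (z, x) = 0,
      forall x, x \in F -> \sum_(z <- F) q (z, x) = 1 &
      forall x y, x \in F -> y \in F -> mdist x y <= r ->
        \sum_(z <- F) `|q (z, x) - q (z, y)| <= e].

(** Normalise the family of [gram_family] to have square sum [1] at each point, assign
    each of its vectors to a point of its support, and let [q (z, x)] be the sum of the
    squares of the values at [x] of the vectors assigned to [z]. *)
Lemma finite_partition (r e : R) : operator_norm_localisation X -> 0 < r -> 0 < e ->
  exists S : R, forall F : seq X, uniq F -> exists q, partition_on r e S F q.
Proof.
move=> onl r0 e0.
(* the normalised Gram matrix is at least [(1 - 2 * d) / (1 + d) >= 1 - 4 * d] near the
   diagonal, and [sqr_variation_l1] needs [1 - e ^+ 2 / 8] *)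
pose d := Num.min 1 (e ^+ 2 / 8) / 4.
have d0 : 0 < d by rewrite divr_gt0// lt_min ltr01 divr_gt0// exprn_gt0.
have d1 : 4 * d <= 1 by rewrite /d mulrC mulfVK// ge_min lexx.
have de : 4 * d <= e ^+ 2 / 8 by rewrite /d mulrC mulfVK// ge_min lexx orbT.
have c01 : 0 < 1 - d / 2 < 1 by apply/andP; split; lra.
have [s s0 Hs] := onl _ _ c01 r0.
exists (s + 2 * r) => F uF.
pose I := seq_sub F; pose pt (i : I) : X := val i.
have pt_inj : injective pt by exact: val_inj.
have sumF (G : X -> R) : \sum_(x <- F) G x = \sum_(i : I) G (pt i).
  rewrite -(sum_codom pt G); apply: perm_big; apply: uniq_perm => //.
    exact: uniq_codom.
  move=> x; apply/idP/mapP => [xF|[i _ ->]]; last exact: valP.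
  by exists (SeqSub xF); rewrite ?mem_enum.
have [c_gt0 _] := andP c01.
have d_lt : 1 - d < 1 - d / 2 by lra.
have d_le : 1 - d <= 1 by lra.
have [J [V [Vloc Vdiag Vclose]]] :=
  @gram_family R X I pt pt_inj _ _ _ _ Hs c_gt0 d_lt d_le (ltW r0) (ltW s0) _ d0.
pose K i := \sum_j V j i ^+ 2.
have Kd i : 1 - d < K i < 1 + d.
  by have := Vdiag i; rewrite ltr_norml => /andP[k1 k2]; apply/andP; split; rewrite /K; lra.
have K0 i : 0 < K i by case/andP: (Kd i) => k1 _; lra.
pose u i j := V j i / Num.sqrt (K i).
have sqK i : Num.sqrt (K i) ^+ 2 = K i by rewrite sqr_sqrtr// ltW.
have u1 i : \sum_j u i j ^+ 2 = 1.
  under eq_bigr do rewrite expr_div_n sqK.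
  by rewrite -mulr_suml -/(K i) divff// gt_eqF.
have uclose i i' : mdist (pt i) (pt i') <= r -> 1 - e ^+ 2 / 8 <= \sum_j u i j * u i' j.
  move=> /Vclose; set G := \sum_j _ => Gd.
  have -> : \sum_j u i j * u i' j = G / (Num.sqrt (K i) * Num.sqrt (K i')).
    by rewrite mulr_suml; apply: eq_bigr => j _; rewrite /u invfM; ring.
  have sqb k : 0 < Num.sqrt (K k) /\ Num.sqrt (K k) ^+ 2 <= 1 + d.
    by rewrite sqrtr_gt0 K0 sqK; split => //; case/andP: (Kd k); lra.
  have [a0 a1] := sqb i; have [b0 b1] := sqb i'.
  move: (Num.sqrt (K i)) (Num.sqrt (K i')) a0 a1 b0 b1 => a b a0 a1 b0 b1.
  rewrite ler_pdivlMr ?mulr_gt0//.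
  have ab : a * b <= 1 + d by have := sqr_ge0 (a - b); rewrite sqrrB; lra.
  apply: (@le_trans _ _ ((1 - 4 * d) * (a * b))).
    by rewrite ler_wpM2r ?mulr_ge0 ?(ltW a0) ?(ltW b0)//; lra.
  apply: (@le_trans _ _ ((1 - 4 * d) * (1 + d))); first by rewrite ler_wpM2l//; lra.
  have : 0 <= d * d by rewrite mulr_ge0 ?ltW.
  lra.
pose cen j : option I := [pick i | V j i != 0].
have cenP j i : V j i != 0 -> exists2 a, cen j = Some a & V j a != 0.
  by rewrite /cen; case: pickP => [a Va _|/(_ i) /= ->//]; exists a.
pose Q a i := \sum_(j | cen j == Some a) u i j ^+ 2.
have sum_cen (G : J -> R) : (forall j, cen j = None -> G j = 0) ->
    \sum_a \sum_(j | cen j == Some a) G j = \sum_j G j.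
  move=> G0; rewrite (exchange_big_dep xpredT)//=; apply: eq_bigr => j _.
  case: (cen j) (G0 j) => [a _|/(_ erefl) ->]; last by rewrite big1.
  by rewrite (big_pred1 a)// => b; rewrite eq_sym.
have u_cen i j : cen j = None -> u i j = 0.
  move=> cj; have [Vji|/cenP[a]] := eqVneq (V j i) 0; last by rewrite cj.
  by rewrite /u Vji mul0r.
have Q0 a i : 0 <= Q a i by apply: sumr_ge0 => j _; exact: sqr_ge0.
have Qsum i : \sum_a Q a i = 1.
  by rewrite sum_cen// => j cj; rewrite u_cen// expr0n.
have Qfar a i : s + 2 * r < mdist (pt a) (pt i) -> Q a i = 0.
  move=> far; apply: big1 => j; rewrite /cen; case: pickP => // b Vb /eqP[ba].
  rewrite ba in Vb; have [Vi|Vi] := eqVneq (V j i) 0.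
    by rewrite /u Vi mul0r expr0n.
  by move: far; rewrite ltNge (Vloc j a i).
have Qvar i i' : mdist (pt i) (pt i') <= r -> \sum_a `|Q a i - Q a i'| <= e.
  move=> ii'; apply: (@le_trans _ _ (\sum_j `|u i j ^+ 2 - u i' j ^+ 2|)).
    rewrite -sum_cen => [|j cj]; last by rewrite !u_cen// subrr normr0.
    apply: ler_sum => a _; rewrite /Q -sumrB; exact: ler_norm_sum.
  by apply: sqr_variation_l1 => //; exact: uclose.
pose q (zx : X * X) := if (insub zx.1 : option I, insub zx.2 : option I) is (Some a, Some i)
  then Q a i else 0.
have qpt a i : q (pt a, pt i) = Q a i by rewrite /q /= !valK.
exists q; split.
- move=> [z x]; rewrite /q /=; case: insub => [a|]; last by rewrite lexx ler01.
  case: insub => [i|]; last by rewrite lexx ler01.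
  by rewrite Q0/= -(Qsum i) (bigD1 a)//= lerDl sumr_ge0.
- move=> z x zx; rewrite /q /=; case: insubP => [a _ az|//].
  by case: insubP => [i _ ix|//]; apply: Qfar; rewrite /pt az ix.
- move=> x xF; have -> : x = pt (SeqSub xF) by [].
  by rewrite sumF -(Qsum (SeqSub xF)); apply: eq_bigr => a _; rewrite qpt.
- move=> x y xF yF xy; rewrite -[x]/(pt (SeqSub xF)) -[y]/(pt (SeqSub yF)) sumF.
  under eq_bigr do rewrite !qpt.
  exact: Qvar.
Qed.

(** The conditions on a partition at given points concern finitely many of its values
    once the finite subset contains the balls about them; so they pass to a cluster point
    of the partitions on finite subsets. *)
Lemma localisation_property_A (p : R) : 1 <= p -> bounded_geometry X ->
  operator_norm_localisation X -> property_A X p.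
Proof.
move=> p1 hX onl; apply: l1_property_A => // r e r0 e0.
have [S HS] := finite_partition onl r0 e0.
have HS' F : exists q, uniq F -> partition_on r e S F q.
  by have [/HS[q Hq]|//] := boolP (uniq F); [exists q|exists (fun=> 0)].
pose f F := projT1 (cid (HS' F)).
have fP F uF := projT2 (cid (HS' F)) uF.
pose f' F := if uniq F then f F else fun=> 0.
have [|g gP] := @unit_cube_cluster R X (X * X)%type f'.
  move=> F zx; rewrite /f'; case: ifP => [uF|]; last by rewrite lexx ler01.
  by have [/(_ zx)] := fP F uF.
have {}gP (t : seq (X * X)) (F0 : seq X) eta : 0 < eta -> exists F,
    [/\ uniq F, {subset F0 <= F} & \sum_(j <- t) `|f F j - g j| < eta].
  by move=> /(gP t F0)[F [uF sF]]; rewrite /f' uF; exists F.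
have [M [bs bsP]] := ball_enumeration hX S.
exists (S + S), X, M, (fun z x => g (z, x)), bs.
have g0 z x : 0 <= g (z, x).
  apply/ler_addgt0Pr => eta eta0; have [F [uF _]] := gP [:: (z, x)] [::] _ eta0.
  rewrite big_seq1 ltr_norml => /andP[_]; have [/(_ (z, x))/andP[+ _] _ _ _] := fP F uF.
  by move=> fF fg; apply: le_trans fF _; rewrite addrC -lerBlDr ltW.
have gfar z x : S < mdist z x -> g (z, x) = 0.
  move=> zx; apply/eqP; rewrite eq_le g0 andbT; apply/ler_addgt0Pr => eta eta0.
  have [F [uF _]] := gP [:: (z, x)] [::] _ eta0.
  rewrite big_seq1 ltr_norml => /andP[+ _]; have [_ /(_ z x zx) + _ _] := fP F uF.
  by rewrite -/(f F) => ->; rewrite sub0r ltrN2 add0r => /ltW.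
have gnear z x : g (z, x) != 0 -> mdist z x <= S.
  by move=> gzx; rewrite leNgt; apply: contra gzx => /gfar ->.
split => //.
- move=> z x y /gnear zx /gnear zy; apply: le_trans (metric_triangle _ z _) _.
  by rewrite metric_sym lerD.
- move=> x; have [ub bM bE] := bsP x; split => // z; rewrite bE -ltNge metric_sym.
  exact: gfar.
- move=> x; have [ub bM bE] := bsP x; apply/eqP; rewrite -subr_eq0 -normr_eq0.
  rewrite eq_le normr_ge0 andbT; apply/ler_addgt0Pr => eta eta0; rewrite add0r.
  have [F [uF sF /ltW Feta]] := gP [seq (z, x) | z <- bs x] (x :: bs x) _ eta0.
  rewrite big_map in Feta; apply: le_trans Feta.
  have [_ far one _] := fP F uF; rewrite -/(f F) in far one.
  rewrite -(one x) ?sF ?mem_head// (@sum_eq_subset _ _ (bs x) F)//.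
  + by rewrite -sumrB; apply: le_trans (ler_norm_sum _ _ _) _;
      apply: ler_sum => z _; rewrite distrC.
  + by move=> z zb; apply: sF; rewrite inE zb orbT.
  + by move=> z; rewrite bE -ltNge metric_sym => /far.
- move=> x y t ut xy; apply/ler_addgt0Pr => eta eta0.
  have [F [uF sF /ltW Feta]] :=
    gP ([seq (z, x) | z <- t] ++ [seq (z, y) | z <- t]) (x :: y :: t) _ eta0.
  rewrite big_cat/= !big_map -big_split/= in Feta.
  have [_ _ _ /(_ x y)] := fP F uF; rewrite -/(f F) !sF ?inE ?eqxx ?orbT// => /(_ isT isT xy).
  move=> var; have {}var : \sum_(z <- t) `|f F (z, x) - f F (z, y)| <= e.
    apply: le_trans var; apply: sum_le_subset => // z zt.
    by apply: sF; rewrite !inE zt !orbT.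
  apply: le_trans (lerD var Feta); rewrite -big_split/=; apply: ler_sum => z _.
  have -> : g (z, x) - g (z, y) = (f F (z, x) - f F (z, y)) +
      (- (f F (z, x) - g (z, x)) + (f F (z, y) - g (z, y))) by ring.
  by apply: le_trans (ler_normD _ _) _; rewrite lerD2l (le_trans (ler_normD _ _))// normrN.
Qed.

End LocalisationToPropertyA.

(** * The equivalence *)

Theorem proposition6p3 (R : realType) (X : pmetricType R) (p : R)
    (hp : 1 <= p) (hX : bounded_geometry X) :
  [<-> property_A X p;
       metric_sparsification X;
       forall eps L M : R, 0 < eps -> 0 < L -> 0 < M ->
         exists2 s : R, 0 < s &
           forall b : bounded_op R X, opnorm b <= M ->
             Commut L (eps / 6) b ->
             exists v : ell2 R X,
               [/\ l2norm v = 1, (diam (supp v) <= s%:E)%E &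
                   opnorm b - eps <= l2norm (b v)];
       forall c L : R, 0 < c < 1 -> 0 < L ->
         exists2 s : R, 0 < s &
           forall b : bounded_op R X, opnorm b = 1 ->
             Commut L ((1 - c) / 6) b ->
             exists v : ell2 R X,
               [/\ l2norm v = 1, (diam (supp v) <= s%:E)%E &
                   c <= l2norm (b v)];
       operator_norm_localisation X].
Proof.
tfae.
- exact: property_A_sparsification.
- by move=> spX eps L M; exact: sparsification_localises.
- move=> H c L /andP[c0 c1] L0.
  have [||s s0 Hs] := H (1 - c) L 1 _ L0; [lra|exact: ltr01|].
  exists s => // b b1 Cb; have [||v [v1 vs bv]] := Hs b; rewrite ?b1//.
  by exists v; split => //; move: bv; rewrite b1 opprB addrC subrK.
- move=> H c r c01 r0; have [_ c1] := andP c01.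
  have eps0 : 0 < (1 - c) / 6 by lra.
  have [L L0 HL] := propagation_Commut hX r0 eps0.
  have [s s0 Hs] := H c L c01 L0; exists s => // a pa a1.
  by apply: Hs => //; exact: HL.
- exact: localisation_property_A.
Qed.
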